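(* The following statements hold. (1) The sets $$S=\{(p,q)\in[0,1]^2:\ p<p_{0,c}\ \text{ or }\ (p\ge p_{0,c}\text{ and }q<q_c(p))\},\qquad U=\{(p,q)\in[0,1]^2:\ p>p_{0,c}\ \text{ and }\ q>q_c(p)\}$$ are open in $[0,1]^2$. There is exponential decay in $S$, i.e. for every $(p,q)\in S$ there exists $c>0$ such that $\theta_n(p,q)\le\exp(-cn)$ for all $n$ large enough; and $\theta(p,q)>0$ for every $(p,q)\in U$. (2) Let $\gamma=(\gamma_p,\gamma_q):[0,1]\to[0,1]^2$ be a continuous path such that there exists $t_c\in\,]0,1[$ with $\theta(\gamma(t))=0$ for all $t\in[0,t_c[$ and $\theta(\gamma(t))>0$ for all $t\in\,]t_c,1]$. Then $\gamma_p(t_c)\ge p_{0,c}$ and $\gamma_q(t_c)=q_c(\gamma_p(t_c))$.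
   Context: Combined site and bond Bernoulli percolation on $\mathbb Z^d$ ($d$ a positive integer), with site parameter $q\in[0,1]$ and bond parameter $p\in[0,1]$, is represented as site percolation on the following graph $G=(V,E)$: $V$ is the set of $x\in\mathbb Z^d$ having at most one odd coordinate, and edges join vertices at $\ell^1$-distance $1$. Let $V_0=2\mathbb Z^d$ (playing the role of the original sites) and $V_1=V\setminus V_0$ (playing the role of the original bonds). All vertices of $V$ are independently occupied (state $\omega(x)=1$) or empty (state $0$), with probability $q$ of being occupied for vertices in $V_0$ and probability $p$ for vertices in $V_1$. For an integer $n\ge 0$, $L_n=\{x\in V:\|x\|_\infty\le n\}$ and $\partial L_n=\{x\in V:\|x\|_\infty=n\}$. For $x\in V$ and $W\subset V$, $x\leftrightarrow W$ means that there is a path in $G$ from $x$ to a vertex of $W$ all of whose vertices (endpoints included) are occupied, with the convention that $x\leftrightarrow x$ always holds. $0\leftrightarrow\infty$ means that $0$ lies in an infinite connected component of occupied vertices. $\theta_n(p,q)=\mathbb P(0\leftrightarrow\partial L_n)$ and $\theta(p,q)=\mathbb P(0\leftrightarrow\infty)$. $p_{0,c}$ is the critical probability of standard Bernoulli bond percolation on $\mathbb Z^d$ (i.e. $p_{0,c}=\inf\{p:\theta(p,1)>0\}$). For $p_0\in[p_{0,c},1]$, $q_c(p_0)$ is the critical value of $q$ on the line $p=p_0$, i.e. $q_c(p_0)=\sup\{q\in[0,1]:\theta(p_0,q)=0\}$. Notation: $]a,b[$, $[a,b[$, $]a,b]$ denote open and half-open intervals. *)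

(* Defs.v *)
From HB Require Import structures.
From mathcomp Require Import all_boot all_order all_algebra.
From mathcomp Require Import all_classical all_reals all_analysis.

Set Implicit Arguments.
Unset Strict Implicit.
Unset Printing Implicit Defensive.

Import Order.TTheory GRing.Theory Num.Theory.
Import numFieldNormedType.Exports.

Local Open Scope classical_set_scope.
Local Open Scope ring_scope.

(* The coordinates of x are x ord0 i for i : 'I_d. *)
Definition odd_coords (d : nat) (x : 'rV[int]_d) : {set 'I_d} :=
  [set i | odd `|x ord0 i|%N]%SET.

Definition in_V (d : nat) (x : 'rV[int]_d) : bool := (#|odd_coords x| <= 1)%N.

Lemma in_V0 (d : nat) : in_V (0 : 'rV[int]_d).
Proof.
rewrite /in_V (_ : odd_coords 0 = finset.set0) ?cards0 //.
by apply/setP => i; rewrite !inE mxE.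
Qed.

Definition vertex (d : nat) : Type := {x : 'rV[int]_d | in_V x}.

Definition origin (d : nat) : vertex d := Sub (0 : 'rV[int]_d) (in_V0 d).

Definition in_V0_site (d : nat) (x : vertex d) : bool :=
  odd_coords (val x) == finset.set0.

Definition norm_infty (d : nat) (x : 'rV[int]_d) : nat :=
  (\max_(i < d) `|x ord0 i|)%N.

Definition dist_l1 (d : nat) (x y : 'rV[int]_d) : nat :=
  (\sum_(i < d) `|(x ord0 i - y ord0 i)%R|)%N.

Definition adj (d : nat) : rel (vertex d) :=
  [rel x y | dist_l1 (val x) (val y) == 1%N].

Definition boundary_box (d n : nat) : set (vertex d) :=
  [set x | norm_infty (val x) = n].
Arguments boundary_box : clear implicits.

(* The configuration space {0,1}^V with the product sigma-algebra;
   true stands for occupied. *)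
Definition coordinate_events (d : nat) : set (set (vertex d -> bool)) :=
  [set A | exists v b, A = [set w | w v = b]].

Definition config (d : nat) := g_sigma_algebraType (@coordinate_events d).

Definition state (d : nat) (w : config d) (v : vertex d) : bool := w v.

Definition occ_connected (d : nat) (w : config d) (x y : vertex d) : Prop :=
  exists s : seq (vertex d),
    [/\ path (@adj d) x s, last x s = y & all (state w) (x :: s)].

(* x <-> W, including the convention that x <-> x always holds *)
Definition connected_to (d : nat) (w : config d) (x : vertex d)
    (W : set (vertex d)) : Prop :=
  exists2 y, W y & x = y \/ occ_connected w x y.

(* The occupied cluster of an empty vertex is the empty set. *)
Definition connected_to_infty (d : nat) (w : config d) (x : vertex d) : Prop :=
  infinite_set [set y | occ_connected w x y].

Section Percolation.
Context (R : realType) (d : nat).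
Implicit Types (p q : R) (P : R -> R -> probability (config d) R).

Definition occ_prob p q (v : vertex d) : R := if in_V0_site v then q else p.

Definition independent_states (mu : probability (config d) R) : Prop :=
  forall (s : seq (vertex d)) (B : vertex d -> set bool), uniq s ->
    mu [set w | forall v, v \in s -> B v (state w v)] =
    (\prod_(v <- s) mu [set w | B v (state w v)])%E.

Definition percolation_measure p q (mu : probability (config d) R) : Prop :=
  independent_states mu /\
  forall v, mu [set w | state w v = true] = (occ_prob p q v)%:E.

(* P p q is the percolation measure with bond parameter p and site parameter q;
   it is unique, but only meaningful for parameters in [0, 1]. *)
Definition percolation_family P : Prop :=
  forall p q, 0 <= p <= 1 -> 0 <= q <= 1 -> percolation_measure p q (P p q).

Definition theta_n P (n : nat) p q : \bar R :=
  P p q [set w | connected_to w (origin d) (boundary_box d n)].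

Definition theta P p q : \bar R :=
  P p q [set w | connected_to_infty w (origin d)].

Definition pc0 P : R := inf [set p | 0 <= p <= 1 /\ (0 < theta P p 1)%E].

Definition qc P p : R := sup [set q | 0 <= q <= 1 /\ theta P p q = 0%E].

Definition unit_square : set (R * R) :=
  [set x | 0 <= x.1 <= 1 /\ 0 <= x.2 <= 1].

Definition subcritical_set P : set (R * R) :=
  [set x | unit_square x /\ (x.1 < pc0 P \/ pc0 P <= x.1 /\ x.2 < qc P x.1)].

Definition supercritical_set P : set (R * R) :=
  [set x | unit_square x /\ pc0 P < x.1 /\ qc P x.1 < x.2].

Definition relatively_open (A B : set (R * R)) : Prop :=
  exists2 O, open O & B = A `&` O.

End Percolation.

Arguments unit_square {R}.

(* Main.v *)
Require Import Defs.
From mathcomp Require Import all_boot all_order all_algebra.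
From mathcomp Require Import all_classical all_reals all_analysis.
From mathcomp Require Import ring lra zify.
Import Order.TTheory GRing.Theory Num.Theory.
Import numFieldNormedType.Exports.

(* Fix (p, q) and let phi(S), for a finite set S of vertices containing the
   origin, be the expected number of vertices outside S adjacent to the open
   cluster of the origin inside S. Call (p, q) good if phi(S) < 1/2 for some S;
   this is an open condition.
   - If (p, q) is good, exploring the cluster of the origin in S and restarting
     from its exits (a path leaving through a bond continues from one of its two
     end sites, hence the 1/2) gives exponential decay (Simon-Lieb).
   - If (p, q) is not good, raise all parameters at once, 1 - rho becoming
     t (1 - rho). Exploring the clusters of the boundary of the box leaves a
     random unexplored set S; the exits of S are closed and pivotal, so Russo's
     formula yields t g' >= g / 2 for the probability g of not reaching the
     boundary, hence g <= sqrt t uniformly in the box (Duminil-Copin-Tassion).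
   - Multilinearity in the states of a bond and of one of its end sites x shows
     that a factor a can be moved from the parameter of x to that of the bond
     without decreasing connection probabilities, because the bond is a dead end
     when x is closed: theta(p, q a^d) <= theta(p a, q).
   The last point makes qc strictly sensitive to p: it raises both parameters of
   a point with theta = 0 and q to spare, so that subcritical points are exactly
   the good ones, it keeps theta positive when p decreases slightly and q
   increases slightly, and it shows that qc(pc0) = 1. *)

Set Implicit Arguments.
Unset Strict Implicit.
Unset Printing Implicit Defensive.

Local Open Scope classical_set_scope.
Local Open Scope ring_scope.

(** * Finite product expectations *)

Section Expectation.
Context (R : realType) (V : eqType).
Implicit Types (rho : V -> R) (s : seq V) (w : V -> bool) (f g : (V -> bool) -> R).

Definition upd w v b : V -> bool := fun u => if u == v then b else w u.

(* [w] prescribes the states of the vertices outside [s]. *)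
Fixpoint Ex rho s f w : R :=
  if s is v :: s' then
    rho v * Ex rho s' f (upd w v true) + (1 - rho v) * Ex rho s' f (upd w v false)
  else f w.

(** The codomain is arbitrary so that the notion covers events, valued in [Prop], as well as real
    observables. *)
Definition depends_on (X : Type) (D : V -> Prop) (f : (V -> bool) -> X) :=
  forall w w', (forall v, D v -> w v = w' v) -> f w = f w'.

Definition weight rho := forall v, 0 <= rho v <= 1.

Lemma updC w u v a b : u != v -> upd (upd w u a) v b = upd (upd w v b) u a.
Proof.
move=> uv; apply/funext => x; rewrite /upd.
by case: eqP => // ->; case: eqP => // uv'; rewrite uv' eqxx in uv.
Qed.

Lemma updxx w v a b : upd (upd w v a) v b = upd w v b.
Proof. by apply/funext => x; rewrite /upd; case: eqP. Qed.

Lemma upd_id w v : upd w v (w v) = w.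
Proof. by apply/funext => x; rewrite /upd; case: eqP => // ->. Qed.

Lemma upd_same w v b : upd w v b v = b.
Proof. by rewrite /upd eqxx. Qed.

Lemma upd_other w u v b : u != v -> upd w v b u = w u.
Proof. by rewrite /upd => /negbTE ->. Qed.

Lemma eq_Ex rho s f g : f =1 g -> Ex rho s f =1 Ex rho s g.
Proof. by move=> /funext ->. Qed.

Lemma eq_Ex_weight rho rho' s f : {in s, rho =1 rho'} ->
  Ex rho s f =1 Ex rho' s f.
Proof.
elim: s => [//|v s IH] e w /=; rewrite e ?mem_head // !IH // => u us;
  by apply: e; rewrite inE us orbT.
Qed.

Lemma ExD rho s f g w :
  Ex rho s (fun w => f w + g w) w = Ex rho s f w + Ex rho s g w.
Proof. by elim: s w => [//|v s IH] w /=; rewrite !IH; ring. Qed.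

Lemma ExZ rho s c f w : Ex rho s (fun w => c * f w) w = c * Ex rho s f w.
Proof. by elim: s w => [//|v s IH] w /=; rewrite !IH; ring. Qed.

Lemma Ex_cst rho s c w : Ex rho s (fun=> c) w = c.
Proof. by elim: s w => [//|v s IH] w /=; rewrite !IH; ring. Qed.

Lemma ExB rho s f g w :
  Ex rho s (fun w => f w - g w) w = Ex rho s f w - Ex rho s g w.
Proof. by elim: s w => [//|v s IH] w /=; rewrite !IH; ring. Qed.

Lemma Ex_sum (I : Type) (r : seq I) (Q : pred I) rho s (F : I -> (V -> bool) -> R) w :
  Ex rho s (fun w => \sum_(i <- r | Q i) F i w) w = \sum_(i <- r | Q i) Ex rho s (F i) w.
Proof.
elim: r => [|i r IH].
  rewrite big_nil -[RHS](Ex_cst rho s 0 w).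
  by apply: eq_Ex => w'; rewrite big_nil.
rewrite big_cons -IH; case: ifP => Qi.
  by rewrite -ExD; apply: eq_Ex => w'; rewrite big_cons Qi.
by apply: eq_Ex => w'; rewrite big_cons Qi.
Qed.

(* A relation between configurations that survives all updates plays the
   role of a monotone coupling. *)
Lemma Ex_le_rel (Q : (V -> bool) -> (V -> bool) -> Prop) rho s f g w w' :
  weight rho ->
  (forall u b w1 w2, u \in s -> Q w1 w2 -> Q (upd w1 u b) (upd w2 u b)) ->
  (forall w1 w2, Q w1 w2 -> f w1 <= g w2) ->
  Q w w' -> Ex rho s f w <= Ex rho s g w'.
Proof.
move=> rho01; elim: s w w' => [|v s IH] w w' Qu fg Qw /=; first exact: fg.
have /andP[r0 r1] := rho01 v.
have IHs b : Ex rho s f (upd w v b) <= Ex rho s g (upd w' v b).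
  apply: IH => //; last by apply: Qu => //; rewrite mem_head.
  by move=> u b' w1 w2 us; apply: Qu; rewrite inE us orbT.
by rewrite lerD // ler_wpM2l // subr_ge0.
Qed.

Lemma Ex_le rho s f g w : weight rho -> (forall w, f w <= g w) ->
  Ex rho s f w <= Ex rho s g w.
Proof.
move=> rho01 fg; apply: (Ex_le_rel (Q := eq)) => //.
  by move=> u b w1 w2 _ ->.
by move=> w1 w2 ->.
Qed.

Lemma Ex_ge0 rho s f w : weight rho -> (forall w, 0 <= f w) -> 0 <= Ex rho s f w.
Proof. by move=> rho01 f0; rewrite -(Ex_cst rho s 0 w); apply: Ex_le. Qed.

Definition increasing f := forall w w', (forall v, w v -> w' v) -> f w <= f w'.

Lemma Ex_increasing rho s f : weight rho -> increasing f -> increasing (Ex rho s f).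
Proof.
move=> rho01 fi w w' ww'.
apply: (Ex_le_rel (Q := fun w w' => forall v, w v -> w' v)) => //.
by move=> u b w1 w2 _ h v; rewrite /upd; case: eqP => // _; apply: h.
Qed.

Lemma increasing_upd f w v : increasing f -> f (upd w v false) <= f (upd w v true).
Proof. by move=> fi; apply: fi => u; rewrite /upd; case: eqP. Qed.

(** One coordinate at a time: raising a single parameter from [x] to [y] changes the average by
    [(y - x) * (b1 - b0)], which is nonnegative because the average is increasing in that
    coordinate. *)
Lemma Ex_le_weight rho rho' s f w : weight rho -> weight rho' ->
  {in s, forall v, rho v <= rho' v} -> increasing f -> Ex rho s f w <= Ex rho' s f w.
Proof.
move=> r01 r01' + fi; elim: s w => [//|v s IH] w rr /=.
have {}IH b : Ex rho s f (upd w v b) <= Ex rho' s f (upd w v b).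
  by apply: IH => u us; apply: rr; rewrite inE us orbT.
have := increasing_upd w v (Ex_increasing s r01' fi).
have /andP[] := r01 v; have /andP[] := r01' v.
have := rr v (mem_head _ _); have := IH true; have := IH false.
move: (Ex rho s f _) (Ex rho s f _) (Ex rho' s f _) (Ex rho' s f _) => a0 a1 b1 b0.
move: (rho v) (rho' v) => x y h1 h2 h3 h4 h5 h6 h7 h8.
apply: (@le_trans _ _ (x * b1 + (1 - x) * b0)).
  by rewrite lerD // ler_wpM2l // subr_ge0.
rewrite -subr_ge0 (_ : _ - _ = (y - x) * (b1 - b0)); last by ring.
by rewrite mulr_ge0 // subr_ge0.
Qed.

Lemma Ex_depends D rho s f : depends_on D f -> depends_on D (Ex rho s f).
Proof.
move=> fD; elim: s => [//|v s IH] w w' ww' /=.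
by congr (_ * _ + _ * _); apply: IH => u Du; rewrite /upd ww'.
Qed.

Lemma Ex_upd_notin D rho s f w v b : depends_on D f -> ~ D v ->
  Ex rho s f (upd w v b) = Ex rho s f w.
Proof.
move=> fD Dv; apply: (Ex_depends rho s fD) => u Du.
by rewrite upd_other //; apply/eqP => uv; apply: Dv; rewrite -uv.
Qed.

Lemma Ex_background rho s f w w' : depends_on (fun v => v \in s) f ->
  Ex rho s f w = Ex rho s f w'.
Proof.
(* Generalised over the set [D] of coordinates on which the two backgrounds already agree; [D] grows
   by each vertex that is averaged. *)
suff gen D : depends_on (fun v => D v \/ v \in s) f ->
    (forall v, D v -> w v = w' v) -> Ex rho s f w = Ex rho s f w'.
  by move=> h; apply: (gen (fun=> False)) => // x y h'; apply: h => v vs; apply: h'; right.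
elim: s D w w' => [|v s IH] D w w' fD ww' /=.
  by apply: fD => u [/ww'|].
by congr (_ * _ + _ * _); apply: (IH (fun u => D u \/ u = v)) => [x y h|u];
  try (by apply: fD => u [Du|]; [|rewrite inE => /orP[/eqP|]] => *; apply: h; auto);
  rewrite /upd; case: eqP => // uv [/ww'|].
Qed.

(** Each averaged coordinate lies on one side of [D], so one of the two factors is constant in it
    and can be pulled out. *)
Lemma Ex_indep D rho s f g w : depends_on D f -> depends_on (fun v => ~ D v) g ->
  Ex rho s (fun w => f w * g w) w = Ex rho s f w * Ex rho s g w.
Proof.
move=> fD gD; elim: s w => [//|v s IH] w /=; rewrite !IH.
have [Dv|nDv] := pselect (D v).
  have nn : ~ ~ D v by apply.
  by rewrite !(Ex_upd_notin _ _ _ _ gD nn); ring.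
by rewrite !(Ex_upd_notin _ _ _ _ fD nDv); ring.
Qed.

Lemma Ex_perm rho s s' f : perm_eq s s' -> Ex rho s f =1 Ex rho s' f.
Proof.
have swap u v t w : Ex rho (u :: v :: t) f w = Ex rho (v :: u :: t) f w.
  have [->//|uv] := eqVneq u v.
  by rewrite /= ![upd (upd w u _) v _]updC //; ring.
have front v t1 t2 w : Ex rho (t1 ++ v :: t2) f w = Ex rho (v :: t1 ++ t2) f w.
  elim: t1 w => [//|u t1 IH] w.
  by rewrite -[RHS]swap /= !IH.
elim: s s' => [|v s IH] s'.
  by move/perm_size/esym/size0nil => -> w.
move=> ps w; have vs' : v \in s' by rewrite -(perm_mem ps) mem_head.
case/splitPr: vs' ps => t1 t2 ps.
have {}ps : perm_eq s (t1 ++ t2).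
  by rewrite -(perm_cons v) (perm_trans ps) // -cat1s perm_catCA.
by rewrite front /= !(IH _ ps).
Qed.

Lemma Ex_filter D (a : pred V) rho s f w : depends_on D f -> (forall v, D v -> a v) ->
  Ex rho s f w = Ex rho [seq v <- s | a v] f w.
Proof.
move=> fD Da; elim: s w => [//|v s IH] w /=; case: ifPn => av /=; rewrite !IH //.
have nDv : ~ D v by move/Da; apply/negP.
by rewrite !(Ex_upd_notin _ _ _ _ fD nDv); ring.
Qed.

Lemma Ex_support D rho s s' f w : depends_on D f ->
  uniq s -> uniq s' -> (forall v, D v -> v \in s /\ v \in s') ->
  Ex rho s f w = Ex rho s' f w.
Proof.
move=> fD us us' Dss.
rewrite (Ex_filter (a := fun v => `[< D v >]) rho s w fD); last by move=> v /asboolP.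
rewrite (Ex_filter (a := fun v => `[< D v >]) rho s' w fD); last by move=> v /asboolP.
apply: Ex_perm; apply: uniq_perm; rewrite ?filter_uniq // => v; rewrite !mem_filter.
by case: asboolP => //= /Dss[-> ->].
Qed.

Lemma Ex_map (tau sigma : V -> V) rho s f w : cancel tau sigma -> cancel sigma tau ->
  Ex rho (map tau s) f w =
  Ex (rho \o tau) s (fun w' => f (w' \o sigma)) (w \o tau).
Proof.
move=> tauK sigmaK; elim: s w => [|v s IH] w /=.
  by congr f; apply/funext => x /=; rewrite sigmaK.
have e b : upd w (tau v) b \o tau = upd (w \o tau) v b.
  by apply/funext => x; rewrite /upd /= (inj_eq (can_inj tauK)).
by rewrite !IH !e.
Qed.

(** An almost sure statement: [Q] is preserved by every update of nonzero probability. It serves for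
    degenerate parameters, where some vertices are surely open or surely closed. *)
Lemma Ex_as (Q : (V -> bool) -> Prop) rho s f c w :
  (forall u w, rho u != 0 -> Q w -> Q (upd w u true)) ->
  (forall u w, rho u != 1 -> Q w -> Q (upd w u false)) ->
  (forall w, Q w -> f w = c) -> Q w -> Ex rho s f w = c.
Proof.
move=> Q1 Q0 fc; elim: s w => [|v s IH] w Qw /=; first exact: fc.
have [r0|r0] := eqVneq (rho v) 0.
  by rewrite r0 mul0r add0r subr0 mul1r IH //; apply: Q0 => //; rewrite r0 eq_sym oner_eq0.
have [r1|r1] := eqVneq (rho v) 1.
  by rewrite r1 subrr mul0r addr0 mul1r IH //; apply: Q1.
by rewrite !IH; [ring|apply: Q0|apply: Q1].
Qed.

Lemma Ex_continuous (T : topologicalType) (r : V -> T -> R) s f w :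
  (forall v, continuous (r v)) -> continuous (fun x => Ex (r^~ x) s f w).
Proof.
move=> rc; elim: s w => [|v s IH] w x /=; first exact: cvg_cst.
apply: cvgD; apply: cvgM; try exact: IH; first exact: rc.
by apply: cvgB; [exact: cvg_cst|exact: rc].
Qed.

(* Each vertex that is closed under [rho] is opened with probability [1 - t]. *)
Definition sprinkle rho (t : R) : V -> R := fun v => 1 - t * (1 - rho v).

(** A discrete derivative; for an increasing indicator it is the indicator that [v] is pivotal. *)
Definition pivotal f v w : R := f (upd w v true) - f (upd w v false).

Lemma Ex_comp_upd rho s f w v b : v \notin s ->
  Ex rho s (fun w => f (upd w v b)) w = Ex rho s f (upd w v b).
Proof.
elim: s w => [//|u s IH] w /=; rewrite inE negb_or => /andP[vu vs].
by rewrite !IH // ![upd (upd w v b) u _]updC.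
Qed.

(** Russo's formula: the average is affine in each parameter, with the expected pivotality as slope,
    and the parameter of [v] moves at speed [- (1 - rho v)] as [t] grows. *)
Lemma Ex_russo rho s f w (t : R) : uniq s ->
  is_derive t 1 (fun t => Ex (sprinkle rho t) s f w)
    (- \sum_(v <- s) (1 - rho v) * Ex (sprinkle rho t) s (pivotal f v) w).
Proof.
elim: s w => [|v s IH] w /=.
  by rewrite big_nil oppr0 => _; exact: is_derive_cst.
case/andP=> vs us.
have dr : is_derive t 1 (fun t => sprinkle rho t v) (- (1 - rho v)).
  have -> : (fun t => sprinkle rho t v) = cst 1 - (1 - rho v) *: id.
    by apply/funext => x; rewrite /sprinkle [x * _]mulrC.
  by apply: is_derive_eq; rewrite sub0r /GRing.scale /= mulr1.
have d1 := IH (upd w v true) us; have d0 := IH (upd w v false) us.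
have d1r := is_deriveB (is_derive_cst (1 : R) t (1 : R)) dr.
have := is_deriveD (is_deriveM dr d1) (is_deriveM d1r d0).
move=> /is_derive_eq; apply.
rewrite big_cons /= /pivotal !ExB !Ex_comp_upd // !updxx /GRing.scale /=.
under [in RHS]eq_bigr do rewrite mulrDr mulrCA [X in _ + X]mulrCA.
rewrite big_split /= -!mulr_sumr /pivotal.
by rewrite -[(cst 1 - _) t]/(1 - sprinkle rho t v); ring.
Qed.

End Expectation.

(** * Clusters and their exploration *)

Lemma ler_asbool (R : numDomainType) (P Q : Prop) :
  (P -> Q) -> `[< P >]%:R <= `[< Q >]%:R :> R.
Proof. by move=> PQ; case: asboolP => [/PQ/asboolT ->|] //; rewrite ler0n. Qed.

Section Connection.
Context (V : choiceType) (e : rel V).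
Implicit Types (w : V -> bool) (D B k S : V -> bool).

Definition conn w x y : Prop :=
  exists s, [/\ path e x s, last x s = y & all w (x :: s)].

Lemma conn_refl w x : w x -> conn w x x.
Proof. by move=> wx; exists [::]; rewrite /= wx. Qed.

Lemma conn_rcons w x y z : conn w x y -> e y z -> w z -> conn w x z.
Proof.
move=> [s [es <- /= /andP[wx ws]]] eyz wz; exists (rcons s z).
by rewrite rcons_path es eyz last_rcons /= wx all_rcons wz ws.
Qed.

Lemma conn_cons w x y z : w x -> e x y -> conn w y z -> conn w x z.
Proof.
by move=> wx exy [s [es ls ws]]; exists (y :: s); split => //=; rewrite ?exy ?wx.
Qed.

Lemma conn_ind w x (Q : V -> Prop) : (w x -> Q x) ->
  (forall y z, conn w x y -> Q y -> e y z -> w z -> Q z) ->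
  forall y, conn w x y -> Q y.
Proof.
move=> Qx Qs y [s]; elim/last_ind: s y => [|s z IH] y.
  by move=> [_ <- /= /andP[wx _]]; apply: Qx.
rewrite rcons_path last_rcons /= all_rcons => -[/andP[es ez] <- /and3P[wx wz ws]].
have ws' : all w (x :: s) by rewrite /= wx.
by apply: (Qs (last x s)) => //; [exists s|apply: IH].
Qed.

Lemma conn_ind_left w y (Q : V -> Prop) : (w y -> Q y) ->
  (forall x z, w x -> e x z -> conn w z y -> Q z -> Q x) ->
  forall x, conn w x y -> Q x.
Proof.
move=> Qy Qs x [s]; elim: s x => [|z s IH] x.
  by move=> [_ /= xy /andP[wx _]]; rewrite xy in wx *; apply: Qy.
move=> [/= /andP[exz es] ls /andP[wx ws]].
by apply: (Qs _ z) => //; [exists s|apply: IH].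
Qed.

Lemma conn_l w x y : conn w x y -> w x.
Proof. by move=> [s [_ _ /= /andP[]]]. Qed.

Lemma conn_r w x y : conn w x y -> w y.
Proof. by move=> [s [_ <- ws]]; exact: (allP ws _ (mem_last x s)). Qed.

Lemma conn_trans w x y z : conn w x y -> conn w y z -> conn w x z.
Proof. by move=> cxy; apply: conn_ind => // a b _ cxa; apply: conn_rcons. Qed.

Lemma conn_mono w w' x y : (forall v, w v -> w' v) -> conn w x y -> conn w' x y.
Proof.
move=> ww' [s [es ls ws]]; exists s; split=> //.
by apply: sub_all ws.
Qed.

Lemma conn_sym : symmetric e -> forall w x y, conn w x y -> conn w y x.
Proof.
move=> es w x y; apply: conn_ind_left => [|a z wa eaz czy cyz]; first exact: conn_refl.
by apply: conn_rcons cyz _ wa; rewrite es.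
Qed.

Definition masked w D v := w v && D v.

Definition open_cluster D B w : V -> bool :=
  fun z => `[< exists2 b, B b & conn (masked w D) z b >].

(** When [k] is the open cluster of [B] in [D], these are the vertices at which the exploration
    halts. The clause [B z] is there because the exploration starts by inspecting the vertices of
    [B]. *)
Definition bdry D B k : V -> bool :=
  fun z => [&& D z, ~~ k z & B z || `[< exists2 u, k u & e z u >]].

Definition explored D B k z := k z || bdry D B k z.

(** Boundary vertices are closed, since an open one would have joined the cluster. *)
Lemma cluster_bdry D B w z : D z -> w z -> bdry D B (open_cluster D B w) z = false.
Proof.
move=> Dz wz; have mz : masked w D z by rewrite /masked wz.
apply/negP => /and3P[_ /asboolP nk] /orP[Bz|/asboolP[u /asboolP[b Bb cub] ezu]].
  by apply: nk; exists z => //; apply: conn_refl.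
by apply: nk; exists b => //; apply: conn_cons cub.
Qed.

Lemma cluster_sub D B w z : open_cluster D B w z -> w z && D z.
Proof. by move=> /asboolP[b _ /conn_l]. Qed.

(** The stopping-set property: a path can leave the cluster only through a boundary vertex, and
    these are closed in both configurations. *)
Lemma cluster_determined D B w w' :
  (forall v, explored D B (open_cluster D B w) v -> w v = w' v) ->
  open_cluster D B w' = open_cluster D B w.
Proof.
move=> ww'; apply/funext => z; apply/idP/idP.
  move=> /asboolP[b Bb].
  apply: (conn_ind_left (Q := fun x => is_true (open_cluster D B w x))).
    move=> /andP[wb Db]; apply/negPn/negP => nk.
    have bb : bdry D B (open_cluster D B w) b by rewrite /bdry Db nk Bb.
    by move: (bb); rewrite cluster_bdry // ww' // /explored bb orbT.
  move=> x y /andP[wx Dx] exy _ ky; apply/negPn/negP => nk.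
  have bb : bdry D B (open_cluster D B w) x.
    by rewrite /bdry Dx nk; apply/orP; right; apply/asboolP; exists y.
  by move: (bb); rewrite cluster_bdry // ww' // /explored bb orbT.
move=> /asboolP[b Bb czb]; apply/asboolP; exists b => //.
move: z czb; apply: conn_ind_left => [mb|x y mx exy cyb IH].
  apply: conn_refl; rewrite /masked -ww' //; apply/orP; left.
  by apply/asboolP; exists b => //; apply: conn_refl.
have cxb := conn_cons mx exy cyb.
apply: conn_cons exy IH; rewrite /masked -ww' //; apply/orP; left.
by apply/asboolP; exists b.
Qed.

Section Exploration.
Context (R : realType).
Implicit Types (rho : V -> R) (s : seq V) (f : (V -> bool) -> R).

(* The second [Ex] resamples the whole configuration, with the explored cluster
   frozen. *)
Lemma Ex_cluster rho s D B (G : (V -> bool) -> (V -> bool) -> R) w0 :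
  (forall v, D v -> v \in s) ->
  (forall k, depends_on (fun v => ~ explored D B k v) (G k)) ->
  Ex rho s (fun w => G (open_cluster D B w) w) w0 =
  Ex rho s (fun w => Ex rho s (G (open_cluster D B w)) w0) w0.
Proof.
move=> Ds Gd.
(* The possible clusters are subsets of [s]; coding them in a finite type turns conditioning on the
   cluster into a finite sum. *)
pose kk (A : {set seq_sub s}) v := [exists t in A, val t == v].
have split (F : (V -> bool) -> R) w :
    F (open_cluster D B w) = \sum_A (`[< open_cluster D B w = kk A >]%:R * F (kk A)).
  rewrite (bigD1 [set t | open_cluster D B w (val t)]%SET) //=.
  set A0 := [set t | _]%SET.
  have kA0 : open_cluster D B w = kk A0.
    apply/funext => v; apply/idP/existsP => [kv|[t]].
      have [_ Dv] := andP (cluster_sub kv).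
      by exists (SeqSub (Ds _ Dv)); rewrite inE /= kv eqxx.
    by rewrite inE => /andP[kt /eqP <-].
  rewrite asboolT // mul1r -kA0 big1 ?addr0 // => A nA.
  rewrite asboolF ?mul0r // => kA; case/eqP: nA; apply/setP => t; rewrite inE kA.
  apply/idP/existsP => [tA|[t' /andP[t'A /eqP/val_inj <-]]//].
  by exists t; rewrite tA eqxx.
under eq_Ex do rewrite (split (fun k => G k _)).
under [RHS]eq_Ex do rewrite (split (fun k => Ex rho s (G k) w0)).
rewrite !Ex_sum; apply: eq_bigr => A _.
(* The event that the cluster equals [kk A] is read on explored vertices only, hence is independent
   of [G (kk A)]. *)
have kd : depends_on (fun v => explored D B (kk A) v)
    (fun w => `[< open_cluster D B w = kk A >]%:R : R).
  move=> w w' ww'; congr (nat_of_bool _)%:R; apply: asbool_equiv_eq; split=> kA.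
    by rewrite -kA; apply: cluster_determined => v; rewrite kA; apply: ww'.
  by rewrite -kA; apply: cluster_determined => v; rewrite kA => /ww'.
rewrite (Ex_indep _ _ _ kd (Gd (kk A))) mulrC -ExZ.
by apply: eq_Ex => w; rewrite mulrC.
Qed.

Lemma Ex_closed rho s v w : uniq s -> v \in s ->
  Ex rho s (fun w => (~~ w v)%:R) w = 1 - rho v.
Proof.
elim: s w => [//|u s IH] w /= /andP[us uu]; rewrite inE.
have [->|uv] := eqVneq v u => /= [_|vs].
  have h b : Ex rho s (fun w => (~~ w u)%:R) (upd w u b) = (~~ b)%:R :> R.
    by rewrite -Ex_comp_upd //; under eq_Ex do rewrite upd_same; rewrite Ex_cst.
  by rewrite !h /=; ring.
by rewrite !IH //; ring.
Qed.

Lemma pivotal_depends f v : depends_on (fun u => ~ u = v) (pivotal f v).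
Proof.
move=> w w' ww'; rewrite /pivotal.
by congr (f _ - f _); apply/funext => u; rewrite /upd; case: eqP => // /ww'.
Qed.

Lemma Ex_closed_pivotal rho s f v w : uniq s -> v \in s ->
  Ex rho s (fun w => (~~ w v)%:R * pivotal f v w) w =
  (1 - rho v) * Ex rho s (pivotal f v) w.
Proof.
move=> us vs; rewrite -(Ex_closed rho w us vs).
apply: (@Ex_indep _ _ (fun u => u = v)); last exact: pivotal_depends.
by move=> w1 w2 ->.
Qed.

Definition exit S o y w : R :=
  `[< exists2 x, e x y & conn (masked w S) o x >]%:R.

(** The Duminil-Copin-Tassion functional in vertex form: the state of the exit [y] itself is not
    taken into account. The list [s] has to contain [S] and its neighbours for this to count all
    exits. *)
Definition phi rho s S o : R :=
  \sum_(y <- s | ~~ S y) Ex rho s (exit S o y) (fun=> false).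

Definition hits s B o w : R := `[< exists2 b, B b & conn (masked w (mem s)) o b >]%:R.

Lemma exit_depends S o y : depends_on S (exit S o y).
Proof.
move=> w w' ww'; rewrite /exit (_ : masked w S = masked w' S) //.
by apply/funext => v; rewrite /masked; case: (boolP (S v)) => [/ww' ->|]; rewrite ?andbF.
Qed.

Lemma exit_increasing S o y : increasing (exit S o y).
Proof.
move=> w w' ww'; apply: ler_asbool => -[x exy c].
by exists x => //; apply: conn_mono c => v /andP[/ww' wv Sv]; rewrite /masked wv.
Qed.

Lemma hits_increasing s B o : increasing (hits s B o).
Proof.
move=> w w' ww'; apply: ler_asbool => -[x exy c].
by exists x => //; apply: conn_mono c => v /andP[/ww' wv Sv]; rewrite /masked wv.
Qed.

Lemma hits_depends s B o : depends_on (fun v => v \in s) (hits s B o).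
Proof.
move=> w w' ww'; rewrite /hits (_ : masked w (mem s) = masked w' (mem s)) //.
by apply/funext => v; rewrite /masked /=; case: (boolP (v \in s)) => [/ww' ->|]; rewrite ?andbF.
Qed.

Lemma phi_le_weight rho rho' s S o : weight rho -> weight rho' ->
  {in s, forall v, rho v <= rho' v} -> phi rho s S o <= phi rho' s S o.
Proof.
move=> r r' rr'; apply: ler_sum => y _.
by apply: Ex_le_weight => //; apply: exit_increasing.
Qed.

End Exploration.
End Connection.

(** * Sharpness *)

Section Sharpness.
Context (R : realType) (V : choiceType) (e : rel V).
Implicit Types (w : V -> bool) (B k S : V -> bool) (rho : V -> R) (s : seq V).

Definition interior s B k : V -> bool :=
  fun v => (v \in s) && ~~ explored e (mem s) B k v.

(** The first term covers the case where [o] itself is explored and not in [k]; it then counts as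
    the single exit. *)
Definition exits s B o k w : R :=
  (bdry e (mem s) B k o)%:R +
  (interior s B k o)%:R *
    \sum_(y <- s | ~~ interior s B k y) exit e R (interior s B k) o y w.

(** Opening a boundary vertex [v] links it to [B] through the explored cluster, and [o] reaches [v]
    by hypothesis, so opening [v] creates the connection that was missing. *)
Lemma pivotal_hits s B o v w : o \in s ->
  ~~ open_cluster e (mem s) B w o -> bdry e (mem s) B (open_cluster e (mem s) B w) v ->
  (o = v \/ exists2 x, e x v & conn e (masked w (mem s)) o x) ->
  w v = false /\ pivotal (hits e R s B o) v w = 1.
Proof.
move=> os nKo bv ov; have /and3P[vs _ Kv] := bv.
have wv : w v = false.
  by apply/negP => wv; move: bv; rewrite cluster_bdry.
split=> //; rewrite /pivotal -[in X in _ - X]wv upd_id.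
rewrite [hits _ _ _ _ _ w](_ : _ = 0); last first.
  by rewrite /hits -/(open_cluster e (mem s) B w o) (negbTE nKo).
rewrite subr0 /hits asboolT //.
have mono u : masked w (mem s) u -> masked (upd w v true) (mem s) u.
  by move=> /andP[wu us]; rewrite /masked /upd us wu if_same.
have mv : masked (upd w v true) (mem s) v by rewrite /masked upd_same.
have [b Bb cvb] : exists2 b, B b & conn e (masked (upd w v true) (mem s)) v b.
  case/orP: Kv => [Bv|/asboolP[u /asboolP[b Bb cub] evu]].
    by exists v => //; apply: conn_refl.
  by exists b => //; apply: conn_cons mv evu (conn_mono mono cub).
exists b => //; case: ov => [->//|[x exv cox]].
exact: conn_trans (conn_rcons (conn_mono mono cox) exv mv) cvb.
Qed.

Lemma exits_le_pivotal s B o w : uniq s -> o \in s ->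
  exits s B o (open_cluster e (mem s) B w) w <=
  \sum_(v <- s) (~~ w v)%:R * pivotal (hits e R s B o) v w.
Proof.
move=> us os; set K := open_cluster _ _ _ _.
have piv0 v : 0 <= (~~ w v)%:R * pivotal (hits e R s B o) v w.
  by rewrite mulr_ge0 // subr_ge0 increasing_upd //; apply: hits_increasing.
rewrite /exits; have [bo|nbo] := boolP (bdry e (mem s) B K o).
  have [_ nKo _] := and3P bo.
  rewrite /interior /explored os bo orbT mul0r addr0.
  rewrite (bigD1_seq o) //= ler_wpDr ?sumr_ge0 //.
  have [-> ->] := pivotal_hits os nKo bo (or_introl erefl).
  by rewrite mul1r.
have [io|] := boolP (interior s B K o); last by rewrite mul0r add0r sumr_ge0.
rewrite mul1r add0r.
have nKo : ~~ K o by case/andP: io => _; rewrite negb_or => /andP[].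
apply: (@le_trans _ _ (\sum_(v <- s | ~~ interior s B K v)
   (~~ w v)%:R * pivotal (hits e R s B o) v w)); last first.
  by rewrite [leRHS](bigID (interior s B K)) /= ler_wpDl // sumr_ge0.
rewrite big_seq_cond [leRHS]big_seq_cond; apply: ler_sum => y /andP[ys nSy].
rewrite /exit; case: asboolP => [[x exy cox]|_]; last exact: piv0.
have /andP[wx /andP[xs nex]] := conn_r cox.
(* The exit [y] is explored. It cannot lie in the cluster, for then its open neighbour [x] in the
   interior would be explored too; so it is a boundary vertex. *)
have by_ : bdry e (mem s) B K y.
  move: nSy; rewrite /interior ys /= negbK => /orP[Ky|//].
  case/negP: nex; apply/orP; have [Kx|nKx] := boolP (K x); [by left|right].
  by rewrite /bdry nKx /= xs; apply/orP; right; apply/asboolP; exists y.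
have [|-> ->] := pivotal_hits os nKo by_; rewrite ?mul1r //.
right; exists x => //; apply: conn_mono cox => u /andP[wu /andP[us' _]].
by rewrite /masked wu.
Qed.

(* The unexplored region is a candidate set for [phi], independent of the
   explored one, and each of its exits is closed and pivotal. *)
Lemma closed_pivotal_lower rho s B o c : weight rho -> uniq s -> o \in s -> c <= 1 ->
  (forall S, S o -> (forall v, S v -> (v \in s) && ~~ B v) -> c <= phi e rho s S o) ->
  c * (1 - Ex rho s (hits e R s B o) (fun=> false)) <=
  \sum_(v <- s) (1 - rho v) * Ex rho s (pivotal (hits e R s B o) v) (fun=> false).
Proof.
move=> rho01 us os c1 cphi; set w0 := fun=> false.
(* Pivotality of [v] does not depend on the state of [v], so the factor [1 - rho v] becomes the
   indicator that [v] is closed. *)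
rewrite big_seq; under eq_bigr => v vs do rewrite -(Ex_closed_pivotal rho _ w0 us vs).
rewrite -big_seq -Ex_sum.
apply: (@le_trans _ _ (Ex rho s (fun w => exits s B o (open_cluster e (mem s) B w) w) w0));
  last by apply: Ex_le => // w; apply: exits_le_pivotal.
(* Given the explored cluster of [B], the interior still carries fresh states, so the exits average
   to [phi] of the interior. *)
rewrite (@Ex_cluster _ e R rho s (mem s) B (exits s B o) w0) //; last first.
  move=> k w w' ww'; rewrite /exits; congr (_ + _ * _); apply: eq_bigr => y _.
  by apply: exit_depends => v /andP[_ /negP]; apply: ww'.
rewrite -{1}(Ex_cst rho s 1 w0) -ExB -ExZ; apply: Ex_le => // w.
rewrite /hits -/(open_cluster e (mem s) B w o); set k := open_cluster _ _ _ _.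
rewrite /exits ExD Ex_cst ExZ Ex_sum -/(phi _ _ _ _ _).
have [ko|nko] := boolP (k o).
  rewrite subrr mulr0 addr_ge0 // mulr_ge0 // sumr_ge0 // => y _.
  by apply: Ex_ge0.
rewrite subr0 mulr1; have [bo|nbo] := boolP (bdry _ _ _ _ _).
  by rewrite /interior os /explored bo orbT mul0r addr0.
have io : interior s B k o by rewrite /interior os /explored (negbTE nko).
rewrite io add0r mul1r; apply: cphi => // v /andP[vs]; rewrite vs /explored negb_or.
move=> /andP[nkv nbv]; apply/negP => Bv; case/negP: nbv.
by rewrite /bdry nkv Bv /= vs.
Qed.

Lemma weight_sprinkle rho t : weight rho -> 0 <= t <= 1 -> weight (sprinkle rho t).
Proof.
move=> rho01 /andP[t0 t1] v; have /andP[r0 r1] := rho01 v; rewrite /sprinkle.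
by apply/andP; split; nra.
Qed.

(** The differential inequality makes [g x ^+ 2 / x] nondecreasing on the interval from [t] to 1,
    and its value at 1 is at most 1. *)
Lemma sqr_le_of_derive (g dg : R -> R) (t : R) : 0 < t <= 1 ->
  (forall x : R, is_derive x (1 : R) g (dg x)) ->
  (forall x : R, 0 < x <= 1 -> 0 <= g x <= 1) ->
  (forall x : R, 0 < x <= 1 -> g x <= 2 * (x * dg x)) ->
  g t ^+ 2 <= t.
Proof.
move=> /andP[t0 t1] gd g01 gdg.
pose F (x : R) : R := g x ^+ 2 * x^-1.
have Fd (x : R) : 0 < x -> is_derive x (1 : R) F
    (g x ^+ 2 * - x ^- 2 + x^-1 * (2 * g x * dg x)).
  move=> x0; have xn0 : id x != 0 by rewrite gt_eqF.
  have dx := is_deriveV xn0 (is_derive_id x (1 : R)).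
  have dg2 := is_deriveX 2 (gd x).
  have := is_deriveM dg2 dx; move=> /is_derive_eq; apply.
  by rewrite /GRing.scale /= expr1 mulr1.
have F1 : F t <= F 1.
  apply: (@ger0_derive1_ndecr _ F t 1) => //.
  - by move=> x; rewrite in_itv /= => /andP[tx _]; have [] := Fd x (lt_trans t0 tx).
  - move=> x; rewrite in_itv /= => /andP[tx x1]; have x0 := lt_trans t0 tx.
    rewrite derive1E; have [_ ->] := Fd x x0.
    have xx : 0 < x <= 1 by rewrite x0 ltW.
    have /andP[gx0 _] := g01 x xx; have := gdg x xx.
    rewrite (_ : _ + _ = x^-1 ^+ 2 * (g x * (2 * (x * dg x) - g x))); last first.
      by field; rewrite gt_eqF.
    by move=> h; rewrite mulr_ge0 ?sqr_ge0 // mulr_ge0 // subr_ge0.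
  - apply: derivable_within_continuous => x; rewrite in_itv /= => /andP[tx _].
    by have [] := Fd x (lt_le_trans t0 tx).
have /andP[g0 g1] : 0 <= g 1 <= 1 by apply: g01; rewrite ltr01 lexx.
move: F1; rewrite /F invr1 mulr1 ler_pdivrMr // => /le_trans; apply.
have h : g 1 ^+ 2 <= 1 by rewrite expr_le1.
by rewrite -[leRHS]mul1r ler_wpM2r // ltW.
Qed.

Lemma hits_sprinkle rho s B o t : weight rho -> uniq s -> o \in s -> 0 < t <= 1 ->
  (forall S, S o -> (forall v, S v -> (v \in s) && ~~ B v) ->
     1 / 2 <= phi e rho s S o) ->
  (1 - t) / 2 <= Ex (sprinkle rho t) s (hits e R s B o) (fun=> false).
Proof.
move=> rho01 us os t01 hphi; set f := hits _ _ _ _ _; set w0 := fun=> false.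
pose g x := 1 - Ex (sprinkle rho x) s f w0.
pose dg x := \sum_(v <- s) (1 - rho v) * Ex (sprinkle rho x) s (pivotal f v) w0.
have gd x : is_derive x (1 : R) g (dg x).
  have := is_deriveB (is_derive_cst (1 : R) x (1 : R)) (Ex_russo rho f w0 x us).
  by move=> /is_derive_eq; apply; rewrite sub0r opprK.
have wt x : 0 < x <= 1 -> weight (sprinkle rho x).
  by move=> /andP[x0 x1]; apply: weight_sprinkle => //; rewrite ltW.
have g01 x : 0 < x <= 1 -> 0 <= g x <= 1.
  move=> /wt wx; rewrite /g subr_ge0 lerBlDr lerDl; apply/andP; split.
    rewrite -[leRHS](Ex_cst (sprinkle rho x) s 1 w0); apply: Ex_le => // w.
    by rewrite /f /hits; case: asboolP.
  by apply: Ex_ge0 => // w; rewrite /f /hits ler0n.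
(* This suffices because the square root of [t] is at most [(1 + t) / 2], so [1 - g t] is at least
   [(1 - t) / 2]. *)
suff : g t ^+ 2 <= t.
  have /andP[t0 t1] := t01; rewrite /g; move: (Ex _ _ _ _) => y; nra.
apply: (sqr_le_of_derive t01 gd g01) => x x01; have /andP[x0 x1] := x01.
have := @closed_pivotal_lower (sprinkle rho x) s B o (1 / 2) (wt x x01) us os.
rewrite -/f -/w0 -/(g x) => /(_ ltac:(lra)).
have -> : \sum_(v <- s) (1 - sprinkle rho x v) * Ex (sprinkle rho x) s (pivotal f v) w0
   = x * dg x.
  by rewrite /dg mulr_sumr; apply: eq_bigr => v _; rewrite /sprinkle opprB addrC subrK mulrA.
move=> h; suff : 1 / 2 * g x <= x * dg x by lra.
(* Sprinkling raises every parameter and [phi] is monotone, so the lower bound assumed for [rho]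
   holds along the whole path. *)
apply: h => S So Ss; apply: le_trans (hphi S So Ss) _.
apply: phi_le_weight => //; first exact: wt.
move=> v _; have /andP[r0 r1] := rho01 v; rewrite /sprinkle; nra.
Qed.

End Sharpness.

(** * Trading a site for a bond, and the Simon-Lieb inequality *)

Section Inequalities.
Context (R : realType) (V : choiceType) (e : rel V).
Implicit Types (w : V -> bool) (B k S : V -> bool) (rho : V -> R) (s : seq V).

(* If [v] is a dead end as soon as [x] is closed, then closing [v] costs less
   than closing [x]. *)
Lemma Ex_swap rho rho' s f w x v a : uniq s -> x \in s -> v \in s -> x != v ->
  weight rho' -> 0 <= a <= 1 -> increasing f ->
  (forall w, w x = false -> f (upd w v true) = f (upd w v false)) ->
  rho x = a * rho' x -> rho' v = a * rho v ->
  (forall u, u != x -> u != v -> rho u = rho' u) ->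
  Ex rho s f w <= Ex rho' s f w.
Proof.
move=> us xs vs xv r01 /andP[a0 a1] fi dead rx rv ru.
have vs' : v \in rem x s by rewrite mem_rem_uniq // inE eq_sym xv.
have ps : perm_eq s (x :: v :: rem v (rem x s)).
  by rewrite (perm_trans (perm_to_rem xs)) // perm_cons perm_to_rem.
rewrite !(Ex_perm _ _ ps) /=; set t := rem v _.
have tx u : u \in t -> (u != x) && (u != v).
  by rewrite /t mem_rem_uniq ?rem_uniq // inE mem_rem_uniq // inE => /and3P[-> ->].
have et w' : Ex rho t f w' = Ex rho' t f w'.
  by apply: eq_Ex_weight => u /tx/andP[]; apply: ru.
have vt : v \notin t by apply/negP => /tx; rewrite eqxx andbF.
have d00 : Ex rho' t f (upd (upd w x false) v true) =
           Ex rho' t f (upd (upd w x false) v false).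
  rewrite -!(Ex_comp_upd _ _ _ _ vt); apply: le_anti; apply/andP.
  have upd_x u b (w1 w2 : V -> bool) : u \in t -> w1 = w2 /\ w1 x = false ->
      upd w1 u b = upd w2 u b /\ upd w1 u b x = false.
    by move=> /tx/andP[ux _] [-> w2x]; rewrite upd_other // eq_sym.
  by split; apply: (Ex_le_rel (Q := fun w1 w2 => w1 = w2 /\ w1 x = false)) => //;
    rewrite ?upd_same // => w1 w2 [-> w2x]; rewrite dead.
have h : Ex rho' t f (upd (upd w x false) v false) <=
         Ex rho' t f (upd (upd w x true) v false).
  apply: Ex_increasing => // u; rewrite /upd; case: eqP => // _.
  by case: eqP.
rewrite !et d00 rx rv; move: (r01 x) h.
move: (rho v) (rho' x) (Ex _ _ _ _) (Ex _ _ _ _) (Ex _ _ _ _) => b q F11 F10 F00.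
move=> /andP[q0 _] h.
(* [F11], [F10], [F00] are the averages given the states of [x] and [v], in this order. The terms in
   [F11] cancel, as both sides open [x] and [v] together with the same probability. *)
rewrite -subr_ge0 (_ : _ - _ = (1 - a) * q * (F10 - F00)); last by ring.
by rewrite !mulr_ge0 // subr_ge0.
Qed.

(** The Simon-Lieb inequality. After its last vertex in the cluster of [o] inside [S], a path to [B]
    avoids everything explored, so plain independence bounds the remaining part. *)
Lemma hits_le_phi rho s s' S B o c : symmetric e -> weight rho ->
  uniq s -> uniq s' -> S o ->
  (forall v, S v -> (v \in s) && ~~ B v) ->
  (forall v, S v -> v \in s') ->
  (forall x y, S x -> e x y -> y \in s') ->
  (forall y, y \in s' -> Ex rho s (hits e R s B y) (fun=> false) <= c) ->
  Ex rho s (hits e R s B o) (fun=> false) <= phi e rho s' S o * c.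
Proof.
move=> es rho01 us us' So SB Ss' nS hc; set w0 := fun=> false.
pose K w := open_cluster e S (pred1 o) w.
(* Number of exits [y] of the cluster [k] that reach [B] through unexplored vertices. *)
pose G (k w : V -> bool) : R := \sum_(y <- s' | ~~ S y)
  `[< exists2 x, e x y & k x >]%:R *
  `[< exists2 b, B b &
      conn e (masked w (fun v => (v \in s) && ~~ explored e S (pred1 o) k v)) y b >]%:R.
have Kconn w x : K w x <-> conn e (masked w S) o x.
  split=> [/asboolP[_ /eqP -> c1]|c1]; first exact: (conn_sym es c1).
  by apply/asboolP; exists o; [exact: eqxx|exact: conn_sym c1].
have hG w : hits e R s B o w <= G (K w) w.
  rewrite /hits; case: asboolP => [[b Bb cob]|_]; last first.
    by rewrite sumr_ge0 // => y _; rewrite mulr_ge0.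
  pose D v := (v \in s) && ~~ explored e S (pred1 o) (K w) v.
  have noK v : masked w (mem s) v -> ~~ K w v -> masked w D v.
    move=> /andP[wv vs] nKv; rewrite /masked wv /D (vs : v \in s) /explored (negbTE nKv) /=.
    apply/negP => bv; have /and3P[Sv _ _] := bv.
    by move: bv; rewrite cluster_bdry.
  have nB : ~~ K w b by apply/negP => /cluster_sub/andP[_ /SB/andP[_]]; rewrite Bb.
  (* Followed backwards from [b], the path stays unexplored until it meets the cluster at some [x];
     the vertex after [x] is outside [S], or it would belong to the cluster. *)
  have leave : conn e (masked w D) o b \/
      exists x y, [/\ K w x, ~~ S y, e x y & conn e (masked w D) y b].
    move: (o) cob; apply: conn_ind_left => [mb|x z mx exz _ [czb|]]; last by right.
      by left; apply: conn_refl; apply: noK.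
    have [Kx|nKx] := boolP (K w x); last first.
      by left; apply: conn_cons exz czb; apply: noK.
    right; exists x, z; split=> //; apply/negP => Sz.
    have /andP[wz /andP[zs /norP[nKz _]]] := conn_l czb; case/negP: nKz.
    apply/Kconn; apply: conn_rcons exz _; first exact/Kconn.
    by rewrite /masked wz.
  have wo : w o by have /andP[] := conn_l cob.
  have Ko : K w o by apply/Kconn; apply: conn_refl; rewrite /masked wo.
  case: leave => [/conn_l/andP[_ /andP[_]]|[x [y [Kx Sy exy cyb]]]].
    by rewrite /explored Ko.
  have Sx : S x by have /andP[] := cluster_sub Kx.
  rewrite /G big_mkcond (bigD1_seq y) ?(nS x) //= Sy !asboolT; last 2 first.
  - by exists b.
  - by exists x.
  rewrite mulr1 lerDl sumr_ge0 // => z _.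
  by case: ifP => // _; rewrite mulr_ge0.
apply: (@le_trans _ _ (Ex rho s (fun w => G (K w) w) w0)); first exact: Ex_le.
rewrite (@Ex_cluster _ e R rho s S (pred1 o) G w0); last 2 first.
- by move=> v /SB/andP[].
- move=> k w w' ww'; rewrite /G; apply: eq_bigr => y _; congr (_ * _).
  rewrite (_ : masked w _ = masked w' (fun v => (v \in s) && ~~ explored e S (pred1 o) k v)) //.
  apply/funext => v; rewrite /masked.
  by case: (boolP (explored _ _ _ _ _)) => [|/negP/ww' ->]; rewrite ?andbF.
have -> : phi e rho s' S o * c =
    Ex rho s (fun w => \sum_(y <- s' | ~~ S y) exit e R S o y w * c) w0.
  rewrite Ex_sum /phi mulr_suml; apply: eq_bigr => y _.
  rewrite [RHS](_ : _ = c * Ex rho s (exit e R S o y) w0); last first.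
    by rewrite -ExZ; apply: eq_Ex => w; rewrite mulrC.
  rewrite mulrC; congr (_ * _); apply: (Ex_support (D := S)) => //; first exact: exit_depends.
  by move=> v Sv; split; [apply: Ss'|have /andP[] := SB v Sv].
apply: Ex_le => // w; rewrite /G Ex_sum big_seq_cond [leRHS]big_seq_cond.
apply: ler_sum => y /andP[ys _]; rewrite ExZ ler_pM //.
- by apply: Ex_ge0.
- by apply: ler_asbool => -[x exy /Kconn c1]; exists x.
(* Forgetting that the path avoids the explored vertices only increases the probability. *)
- apply: le_trans (hc y ys); apply: Ex_le => // w'; apply: ler_asbool => -[b Bb cyb].
  by exists b => //; apply: conn_mono cyb => v /andP[wv /andP[vs _]]; rewrite /masked wv.
Qed.

End Inequalities.

(** * The lattice *)

Section Lattice.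
Context (d : nat).
Implicit Types (x y z c : 'rV[int]_d) (u v o : vertex d) (w : vertex d -> bool).

Lemma coordD x y i : (x + y) ord0 i = x ord0 i + y ord0 i.
Proof. by rewrite mxE. Qed.

Lemma coordN x i : (- x) ord0 i = - x ord0 i.
Proof. by rewrite mxE. Qed.

Lemma coordB x y i : (x - y) ord0 i = x ord0 i - y ord0 i.
Proof. by rewrite coordD coordN. Qed.

Lemma norm_le x n : (norm_infty x <= n)%N = [forall i, (`|x ord0 i| <= n)%N].
Proof.
by apply/bigmax_leqP/forallP => h i; [exact: h|move=> _; exact: h].
Qed.

Lemma coord_le_norm x i : (`|x ord0 i| <= norm_infty x)%N.
Proof. by have := leqnn (norm_infty x); rewrite norm_le => /forallP. Qed.

Lemma norm0 : norm_infty (0 : 'rV[int]_d) = 0%N.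
Proof. by apply/eqP; rewrite -leqn0 norm_le; apply/forallP => i; rewrite mxE. Qed.

Lemma norm_triangle x y : (norm_infty (x + y) <= norm_infty x + norm_infty y)%N.
Proof.
rewrite norm_le; apply/forallP => i; rewrite coordD.
have := coord_le_norm x i; have := coord_le_norm y i; lia.
Qed.

Lemma adj_sym : symmetric (@adj d).
Proof.
move=> u v; rewrite /adj /= /dist_l1; congr (_ == _).
by apply: eq_bigr => i _; rewrite distnC.
Qed.

Lemma adjP u v : adj u v -> exists2 i, `|val u ord0 i - val v ord0 i|%N = 1%N &
  forall j, j != i -> val v ord0 j = val u ord0 j.
Proof.
pose F (i : 'I_d) : nat := `|val u ord0 i - val v ord0 i|%N.
rewrite /adj /= => /eqP h; have {}h : (\sum_i F i = 1)%N by [].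
have [i hi] : exists i, F i != 0%N.
  apply/existsP; rewrite -negb_forall; apply/negP => /forallP h0.
  by move: h; rewrite big1 // => i _; apply/eqP.
move: h; rewrite (bigD1 i) //= => h.
have [Fi] : F i = 1%N /\ (\sum_(j < d | j != i) F j == 0)%N.
  move: hi h; case: (F i) => [|m] // _; rewrite addSn => -[] /eqP.
  by rewrite addn_eq0 => /andP[/eqP -> ->].
rewrite sum_nat_eq0 => /forallP h0; exists i => // j ji.
by apply/esym/eqP; rewrite -subr_eq0 -absz_eq0; exact: implyP (h0 j) ji.
Qed.

Lemma adj_norm u v c : adj u v ->
  (norm_infty (val v - c) <= (norm_infty (val u - c)).+1)%N.
Proof.
case/adjP => i hi hj; rewrite norm_le; apply/forallP => j; rewrite coordB.
have := coord_le_norm (val u - c) j; rewrite coordB.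
by have [->|ji] := eqVneq j i; [|rewrite hj //]; lia.
Qed.

Definition box c n : seq (vertex d) :=
  undup (pmap insub [seq c + \row_j ((f j : nat)%:Z - n%:Z)
    | f : {ffun 'I_d -> 'I_(n.*2.+1)}]).

Lemma box_uniq c n : uniq (box c n).
Proof. exact: undup_uniq. Qed.

Lemma mem_box c n v : (v \in box c n) = (norm_infty (val v - c) <= n)%N.
Proof.
rewrite mem_undup mem_pmap_sub; apply/fintype.imageP/idP => [[f _ ->]|h].
  rewrite norm_le; apply/forallP => i; rewrite addrC addKr mxE.
  have aux (k : nat) : (k < n.*2.+1)%N -> (`|(k%:Z - n%:Z)%R| <= n)%N by lia.
  by apply: aux; exact: ltn_ord.
have hi i : (`|(val v ord0 i - c ord0 i + n%:Z)%R| < n.*2.+1)%N.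
  by move: h; rewrite norm_le => /forallP/(_ i); rewrite coordB; lia.
exists [ffun i => Ordinal (hi i)] => //; apply/rowP => i; rewrite coordD mxE ffunE /=.
have aux (a b : int) : (`|(a - b)%R| <= n)%N -> a = b + (`|(a - b + n%:Z)%R|%N%:Z - n%:Z) by lia.
by apply: aux; move: h; rewrite norm_le => /forallP/(_ i); rewrite coordB.
Qed.

(** * Spheres and translations by even vectors *)

Definition sphere c n : vertex d -> bool := fun v => norm_infty (val v - c) == n.

Definition even_row z : bool := odd_coords z == finset.set0.

Lemma even_rowP z : reflect (forall i, odd `|z ord0 i|%N = false) (even_row z).
Proof.
apply: (iffP eqP) => [/setP h i|h]; first by have := h i; rewrite !inE.
by apply/setP => i; rewrite !inE h.
Qed.

Lemma even_row_in_V z : even_row z -> in_V z.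
Proof. by move=> /eqP h; rewrite /in_V h cards0. Qed.

Lemma odd_coordsD x z : even_row z -> odd_coords (x + z) = odd_coords x.
Proof.
move=> /even_rowP h; apply/setP => i; rewrite !inE coordD; have := h i; lia.
Qed.

(** Only used for even [z], where the sum is again a vertex and the default value of [insubd] is
    irrelevant. *)
Definition vshift z v : vertex d := insubd v (val v + z).

Lemma val_shift z v : even_row z -> val (vshift z v) = val v + z.
Proof.
by move=> ez; rewrite val_insubd /in_V odd_coordsD // -/(in_V _) (valP v).
Qed.

Lemma even_rowN z : even_row (- z) = even_row z.
Proof.
apply/even_rowP/even_rowP => h i; have := h i; by rewrite coordN abszN.
Qed.

Lemma shiftK z : even_row z -> cancel (vshift z) (vshift (- z)).
Proof.
move=> ez v; apply: val_inj; rewrite val_shift ?even_rowN // val_shift //.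
by rewrite addrK.
Qed.

Lemma shiftNK z : even_row z -> cancel (vshift (- z)) (vshift z).
Proof. by move=> ez; rewrite -{2}(opprK z); apply: shiftK; rewrite even_rowN. Qed.

Lemma adj_shift z u v : even_row z -> adj (vshift z u) (vshift z v) = adj u v.
Proof.
move=> ez; rewrite /adj /= /dist_l1 !val_shift //; congr (_ == _).
by apply: eq_bigr => i _; rewrite !coordD opprD addrACA subrr addr0.
Qed.

Lemma site_shift z v : even_row z -> in_V0_site (vshift z v) = in_V0_site v.
Proof. by move=> ez; rewrite /in_V0_site val_shift // odd_coordsD. Qed.

Lemma odd_absD (a : int) : odd `|(a + (odd `|a|%N)%:Z)%R|%N = false.
Proof.
case: (boolP (odd `|a|%N)) => h; first by have -> : (nat_of_bool true)%:Z = 1 by []; lia.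
by have -> : (nat_of_bool false)%:Z = 0 by []; lia.
Qed.

Lemma odd_absB (a : int) : odd `|(a - (odd `|a|%N)%:Z)%R|%N = false.
Proof.
case: (boolP (odd `|a|%N)) => h; first by have -> : (nat_of_bool true)%:Z = 1 by []; lia.
by have -> : (nat_of_bool false)%:Z = 0 by []; lia.
Qed.

(** For a bond, [round_up] and [round_down] are its two end sites; a site is fixed by both. The
    default value is never taken. *)
Definition round_up v : vertex d :=
  insubd v (\row_j (val v ord0 j + (odd `|val v ord0 j|)%:Z)).

Definition round_down v : vertex d :=
  insubd v (\row_j (val v ord0 j - (odd `|val v ord0 j|)%:Z)).

Lemma val_round_up v : val (round_up v) = \row_j (val v ord0 j + (odd `|val v ord0 j|)%:Z).
Proof.
rewrite val_insubd even_row_in_V //; apply/even_rowP => i; rewrite mxE; exact: odd_absD.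
Qed.

Lemma val_round_down v :
  val (round_down v) = \row_j (val v ord0 j - (odd `|val v ord0 j|)%:Z).
Proof.
rewrite val_insubd even_row_in_V //; apply/even_rowP => i; rewrite mxE; exact: odd_absB.
Qed.

Lemma round_up_even v : even_row (val (round_up v)).
Proof. rewrite val_round_up; apply/even_rowP => i; rewrite mxE; exact: odd_absD. Qed.

Lemma round_down_even v : even_row (val (round_down v)).
Proof. rewrite val_round_down; apply/even_rowP => i; rewrite mxE; exact: odd_absB. Qed.

Lemma norm_round_up v : (norm_infty (val (round_up v)) <= (norm_infty (val v)).+1)%N.
Proof.
rewrite norm_le val_round_up; apply/forallP => i; rewrite mxE.
have aux (a : int) m : (`|a| <= m)%N -> (`|(a + (odd `|a|%N)%:Z)%R| <= m.+1)%N.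
  case: (odd _); first by have -> : (nat_of_bool true)%:Z = 1 by []; lia.
  by have -> : (nat_of_bool false)%:Z = 0 by []; lia.
exact: aux (coord_le_norm (val v) i).
Qed.

Lemma norm_round_down v : (norm_infty (val (round_down v)) <= (norm_infty (val v)).+1)%N.
Proof.
rewrite norm_le val_round_down; apply/forallP => i; rewrite mxE.
have aux (a : int) m : (`|a| <= m)%N -> (`|(a - (odd `|a|%N)%:Z)%R| <= m.+1)%N.
  case: (odd _); first by have -> : (nat_of_bool true)%:Z = 1 by []; lia.
  by have -> : (nat_of_bool false)%:Z = 0 by []; lia.
exact: aux (coord_le_norm (val v) i).
Qed.

Lemma round_up_site v : in_V0_site v -> round_up v = v.
Proof.
move=> /even_rowP h; apply: val_inj; rewrite val_round_up; apply/rowP => i.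
by rewrite mxE h addr0.
Qed.

Lemma odd_coord_uniq v i j : odd `|val v ord0 i|%N -> odd `|val v ord0 j|%N -> i = j.
Proof.
move=> oi oj; have := valP v; rewrite /in_V leqNgt => /negP h; apply/eqP/negPn/negP => ij.
apply: h; have <- : #|[set i; j]%SET| = 2%N by rewrite cards2 ij.
by apply: subset_leq_card; apply/fintype.subsetP => k; rewrite !inE => /orP[]/eqP ->.
Qed.

Lemma bond_odd v : ~~ in_V0_site v -> exists i, odd `|val v ord0 i|%N.
Proof. by move=> /finset.set0Pn[i]; rewrite inE; exists i. Qed.

(** A step along any coordinate other than the odd one would create a second odd coordinate. *)
Lemma adj_bond v u : ~~ in_V0_site v -> adj v u -> u = round_up v \/ u = round_down v.
Proof.
move=> /bond_odd[i oi] /adjP[j hj hk].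
have ij : j = i.
  apply/eqP/negPn/negP => ji; have ui : odd `|val u ord0 i|%N.
    by rewrite hk // eq_sym.
  have uj : odd `|val u ord0 j|%N.
    have : odd `|val v ord0 j|%N = false.
      by apply/negP => oj; case/eqP: ji; apply: odd_coord_uniq oj oi.
    lia.
  by case/eqP: ji; apply: odd_coord_uniq uj ui.
subst j; have ev k : k != i -> odd `|val v ord0 k|%N = false.
  by move=> ki; apply/negP => ok; case/eqP: ki; apply: odd_coord_uniq ok oi.
have [hi|hi] : val u ord0 i = val v ord0 i + 1 \/ val u ord0 i = val v ord0 i - 1 by lia.
  left; apply: val_inj; rewrite val_round_up; apply/rowP => k; rewrite mxE.
  by have [->|ki] := eqVneq k i; [rewrite oi|rewrite hk // ev // addr0].
right; apply: val_inj; rewrite val_round_down; apply/rowP => k; rewrite mxE.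
by have [->|ki] := eqVneq k i; [rewrite oi|rewrite hk // ev // subr0].
Qed.

(** The distance to [o] grows by at most one per step, so the path can be cut when it first takes
    the value [n]. *)
Lemma conn_sphere w o t n : conn (@adj d) w o t ->
  (n <= norm_infty (val t - val o))%N ->
  exists2 b, sphere (val o) n b & conn (@adj d) (masked w (mem (box (val o) n))) o b.
Proof.
move=> cot; pose m := masked w (mem (box (val o) n)).
have [[tn ct] nt|//] : (norm_infty (val t - val o) <= n)%N /\ conn (@adj d) m o t \/
    exists2 b, sphere (val o) n b & conn (@adj d) m o b.
  move: t cot; apply: conn_ind => [wo|y z _ [[yn cy]|]]; last by right.
    have on : (norm_infty (val o - val o) <= n)%N by rewrite subrr norm0.
    by left; split=> //; apply: conn_refl; rewrite /m /masked wo /= mem_box.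
  move=> yz wz; have [ye|ny] := eqVneq (norm_infty (val y - val o)) n.
    by right; exists y => //; apply/eqP.
  have zn : (norm_infty (val z - val o) <= n)%N.
    by apply: leq_trans (adj_norm _ yz) _; rewrite ltn_neqAle ny.
  by left; split=> //; apply: conn_rcons cy yz _; rewrite /m /masked wz /= mem_box.
by exists t => //; apply/eqP/anti_leq; rewrite tn.
Qed.

End Lattice.

(** * Exponential decay *)

Section Criterion.
Context (R : realType) (d : nat).
Implicit Types (p q a : R) (n m N : nat) (u v o x y : vertex d) (w S : vertex d -> bool).

Notation hitb c n := (hits (@adj d) R (box c n) (sphere c n)).

(** Here the origin has to be occupied even at radius 0, unlike in [theta_n], which is 1 there by
    convention. *)
Definition cross n p q : R :=
  Ex (occ_prob p q) (box 0 n) (hitb 0 n (origin d)) (fun=> false).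

Definition finite_criterion p q := exists m S,
  [/\ S (origin d), forall v, S v -> (norm_infty (val v) < m)%N &
      phi (@adj d) (occ_prob p q) (box 0 m) S (origin d) < 1 / 2].

Lemma weight_occ p q : 0 <= p <= 1 -> 0 <= q <= 1 -> weight (@occ_prob R d p q).
Proof. by move=> hp hq v; rewrite /occ_prob; case: ifP. Qed.

Lemma conn_iso (tau : vertex d -> vertex d) w w' x y :
  (forall u v, adj u v -> adj (tau u) (tau v)) -> (forall v, w v -> w' (tau v)) ->
  conn (@adj d) w x y -> conn (@adj d) w' (tau x) (tau y).
Proof.
move=> ht hw; move: y; apply: conn_ind => [wx|y z _ cy yz wz].
  by apply: conn_refl; apply: hw.
by apply: conn_rcons cy (ht _ _ yz) (hw _ wz).
Qed.

Lemma sphere_sub0 v n : sphere 0 n v = (norm_infty (val v) == n).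
Proof. by rewrite /sphere subr0. Qed.

Lemma mem_box0 v n : (v \in box 0 n) = (norm_infty (val v) <= n)%N.
Proof. by rewrite mem_box subr0. Qed.

(** Even translations preserve adjacency and the distinction between sites and bonds, hence the
    law. *)
Lemma cross_translate p q o n : 0 <= p <= 1 -> 0 <= q <= 1 -> even_row (val o) ->
  Ex (occ_prob p q) (box (val o) n) (hitb (val o) n o) (fun=> false) <= cross n p q.
Proof.
move=> hp hq eo; set z := val o.
have ps : perm_eq (box z n) (map (vshift z) (box 0 n)).
  apply: uniq_perm; rewrite ?map_inj_uniq ?box_uniq //; first exact: can_inj (shiftK eo).
  move=> v; rewrite -{2}(shiftNK eo v) mem_map; last exact: can_inj (shiftK eo).
  by rewrite mem_box mem_box0 val_shift ?even_rowN.
rewrite (Ex_perm _ _ ps) (Ex_map _ _ _ _ (shiftK eo) (shiftNK eo)) /cross.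
rewrite (eq_Ex_weight (rho' := occ_prob p q)); last first.
  by move=> v _ /=; rewrite /occ_prob site_shift.
apply: Ex_le; first exact: weight_occ.
move=> w; apply: ler_asbool => -[b Bb cb]; exists (vshift (- z) b).
  by rewrite sphere_sub0 val_shift // even_rowN.
have -> : origin d = vshift (- z) o.
  by apply: val_inj; rewrite val_shift ?even_rowN // subrr.
apply: conn_iso cb => [u v|v]; first by rewrite adj_shift // even_rowN.
move=> /andP[wv vb]; rewrite /masked (wv : w (vshift (- z) v)) /=.
rewrite mem_box0 val_shift ?even_rowN //.
by rewrite -mem_box.
Qed.

Lemma Ex_hits_le p q o N n : 0 <= p <= 1 -> 0 <= q <= 1 -> even_row (val o) ->
  (norm_infty (val o) + n <= N)%N ->
  Ex (occ_prob p q) (box 0 N) (hitb 0 N o) (fun=> false) <= cross n p q.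
Proof.
move=> hp hq eo oN; apply: le_trans (cross_translate _ hp hq eo).
apply: (@le_trans _ _ (Ex (occ_prob p q) (box 0 N) (hitb (val o) n o) (fun=> false))).
  apply: Ex_le; first exact: weight_occ.
  move=> w; apply: ler_asbool => -[b]; rewrite sphere_sub0 => /eqP Bb cob.
  have [|b' Bb' cb'] := conn_sphere (n := n) cob.
    rewrite -(leq_add2r (norm_infty (val o))) addnC (leq_trans oN) // -Bb.
    by have := norm_triangle (val b - val o) (val o); rewrite subrK.
  exists b' => //; apply: conn_mono cb' => v /andP[/andP[wv _] vb].
  by rewrite /masked wv.
rewrite le_eqVlt; apply/orP; left; apply/eqP.
apply: (Ex_support (D := fun v => v \in box (val o) n)); rewrite ?box_uniq //.
  exact: hits_depends.
move=> v vo; split=> //; move: vo; rewrite mem_box mem_box0.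
have := norm_triangle (val v - val o) (val o); rewrite subrK => h1 h2.
by rewrite (leq_trans h1) // (leq_trans _ oN) // addnC leq_add2l.
Qed.

(** An exit [y] may be a bond, which no even translation carries to the origin. The path then
    continues from one of its two end sites, of norm at most [m.+1]; hence the factor 2. *)
Lemma Ex_hits_le2 p q y N m : 0 <= p <= 1 -> 0 <= q <= 1 ->
  (norm_infty (val y) <= m)%N -> (m < N)%N ->
  Ex (occ_prob p q) (box 0 N) (hitb 0 N y) (fun=> false) <= 2 * cross (N - m.+1) p q.
Proof.
move=> hp hq ym mN.
have up := @Ex_hits_le p q (round_up y) N (N - m.+1) hp hq (round_up_even y).
have dn := @Ex_hits_le p q (round_down y) N (N - m.+1) hp hq (round_down_even y).
have hu := norm_round_up y; have hd := norm_round_down y.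
have {up}up := up ltac:(lia); have {dn}dn := dn ltac:(lia).
rewrite mulr_natl mulr2n; apply: le_trans (lerD up dn).
rewrite -ExD; apply: Ex_le => [|w]; first exact: weight_occ.
have pos z : 0 <= hitb 0 N z w by rewrite /hits ler0n.
have [sy|by_] := boolP (in_V0_site y); first by rewrite round_up_site // lerDl.
rewrite {1}/hits; case: asboolP => [[b]|_]; last by rewrite addr_ge0.
rewrite sphere_sub0 => /eqP Bb [[|z s] [/= ys ls ws]].
  by rewrite ls in ym; lia.
case/andP: ys => yz zs; case/andP: ws => _ ws.
have hz : hitb 0 N z w = 1.
  by rewrite /hits asboolT //; exists b; [rewrite sphere_sub0 Bb|exists s].
by have [<-|<-] := adj_bond by_ yz; rewrite hz ?lerDl ?lerDr.
Qed.

Lemma cross_le_phi p q m N S : 0 <= p <= 1 -> 0 <= q <= 1 -> S (origin d) ->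
  (forall v, S v -> (norm_infty (val v) < m)%N) -> (m < N)%N ->
  cross N p q <= phi (@adj d) (occ_prob p q) (box 0 m) S (origin d) *
                 (2 * cross (N - m.+1) p q).
Proof.
move=> hp hq So Sm mN; apply: hits_le_phi; rewrite ?box_uniq //.
- exact: adj_sym.
- exact: weight_occ.
- move=> v /Sm vm; rewrite mem_box0 sphere_sub0; apply/andP; split; lia.
- by move=> v /Sm vm; rewrite mem_box0 ltnW.
- move=> x y /Sm xm /(adj_norm 0); rewrite mem_box0 !subr0; lia.
- by move=> y; rewrite mem_box0 => ym; apply: Ex_hits_le2.
Qed.

Lemma cross_ge0 n p q : 0 <= p <= 1 -> 0 <= q <= 1 -> 0 <= cross n p q.
Proof. by move=> hp hq; apply: Ex_ge0 => [|w]; [exact: weight_occ|rewrite /hits ler0n]. Qed.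

Lemma cross_le1 n p q : 0 <= p <= 1 -> 0 <= q <= 1 -> cross n p q <= 1.
Proof.
move=> hp hq; rewrite -[leRHS](Ex_cst (@occ_prob R d p q) (box 0 n) 1 (fun=> false)).
by apply: Ex_le => [|w]; [exact: weight_occ|rewrite /hits lern1 leq_b1].
Qed.

Lemma cross_nincr n N p q : 0 <= p <= 1 -> 0 <= q <= 1 -> (n <= N)%N ->
  cross N p q <= cross n p q.
Proof.
move=> hp hq nN; apply: (Ex_hits_le hp hq); last by rewrite norm0.
by apply/even_rowP => i; rewrite mxE.
Qed.

Lemma cross_mono n p q p' q' : 0 <= p <= 1 -> 0 <= q <= 1 ->
  0 <= p' <= 1 -> 0 <= q' <= 1 -> p <= p' -> q <= q' -> cross n p q <= cross n p' q'.
Proof.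
move=> hp hq hp' hq' pp qq; apply: Ex_le_weight; try exact: weight_occ.
  by move=> v _; rewrite /occ_prob; case: ifP.
exact: hits_increasing.
Qed.

Lemma finite_criterion_mono p q p' q' : 0 <= p <= 1 -> 0 <= q <= 1 ->
  0 <= p' <= 1 -> 0 <= q' <= 1 -> p <= p' -> q <= q' ->
  finite_criterion p' q' -> finite_criterion p q.
Proof.
move=> hp hq hp' hq' pp qq [m [S [So Sm hS]]]; exists m, S; split => //.
apply: le_lt_trans hS; apply: phi_le_weight; try exact: weight_occ.
by move=> v _; rewrite /occ_prob; case: ifP.
Qed.

Lemma cross_geometric p q : 0 <= p <= 1 -> 0 <= q <= 1 -> finite_criterion p q ->
  exists a m, [/\ 0 < a < 1, (0 < m)%N & forall n, cross n p q <= a ^+ (n %/ m)].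
Proof.
move=> hp hq [m [S [So Sm hS]]]; set f := phi _ _ _ _ _ in hS.
have f0 : 0 <= f.
  by apply: sumr_ge0 => y _; apply: Ex_ge0 => [|w]; [exact: weight_occ|rewrite /exit ler0n].
(* The maximum with 1/2 keeps the ratio positive, so that its logarithm can be taken later. *)
exists (Num.max (1 / 2) (2 * f)), m.+1; split => //.
  by rewrite lt_max gt_max; apply/andP; split; [apply/orP; left|apply/andP; split]; lra.
set a := Num.max _ _; have a0 : 0 <= a by rewrite le_max; apply/orP; left; lra.
have fa : 2 * f <= a by rewrite le_max lexx orbT.
move=> n; elim/ltn_ind: n => n IH; have [nm|mn] := leqP n m.
  by rewrite divn_small ?ltnS // expr0; apply: cross_le1.
apply: le_trans (cross_le_phi hp hq So Sm mn) _; rewrite -/f.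
have -> : (n %/ m.+1 = ((n - m.+1) %/ m.+1).+1)%N.
  have {1}-> : n = (1 * m.+1 + (n - m.+1))%N by rewrite mul1n subnKC.
  by rewrite divnMDl // add1n.
rewrite exprS mulrCA mulrA; apply: ler_pM => //.
- by rewrite mulr_ge0.
- exact: cross_ge0.
- by apply: IH; lia.
Qed.

Lemma sprinkle_occ p q t :
  sprinkle (@occ_prob R d p q) t = occ_prob (1 - t * (1 - p)) (1 - t * (1 - q)).
Proof. by apply/funext => v; rewrite /sprinkle /occ_prob; case: ifP. Qed.

Lemma cross_sprinkle p q t n : 0 <= p <= 1 -> 0 <= q <= 1 -> 0 < t <= 1 ->
  ~ finite_criterion p q ->
  (1 - t) / 2 <= cross n (1 - t * (1 - p)) (1 - t * (1 - q)).
Proof.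
move=> hp hq ht nC; rewrite /cross -sprinkle_occ; apply: hits_sprinkle => //.
- exact: weight_occ.
- exact: box_uniq.
- by rewrite mem_box0 norm0.
move=> S So Sn; rewrite leNgt; apply/negP => hS; apply: nC; exists n, S; split => // v /Sn.
by rewrite mem_box0 sphere_sub0 ltn_neqAle andbC.
Qed.

End Criterion.

(** * Trading sites for bonds *)

Section Coupling.
Context (R : realType) (d : nat).
Implicit Types (p q a : R) (n m N : nat) (u v o x y : vertex d) (w S : vertex d -> bool).

Notation hitb c n := (hits (@adj d) R (box c n) (sphere c n)).

Lemma round_down_bond v : ~~ in_V0_site v -> round_down v != v.
Proof.
move=> bv; apply/eqP => h; case/negP: bv; rewrite -h; apply: round_down_even.
Qed.

(** The coordinate that attains an even norm is even, so rounding leaves it alone. This is why the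
    trade of sites for bonds is made at even radii. *)
Lemma norm_even_attained v n : sphere 0 n.*2 v ->
  (n.*2 <= norm_infty (val (round_up v)))%N.
Proof.
rewrite sphere_sub0 => /eqP vn; case: n vn => [//|n] vn.
have [i hi] : exists i, `|val v ord0 i|%N = n.+1.*2.
  apply/not_existsP => h; have : (norm_infty (val v) <= n.*2.+1)%N; last by rewrite vn; lia.
  rewrite norm_le; apply/forallP => i; have := h i; have := coord_le_norm (val v) i.
  by rewrite vn; move: `|_|%N => k; lia.
apply: leq_trans (coord_le_norm (val (round_up v)) i).
by rewrite val_round_up mxE hi odd_double addr0 hi.
Qed.

(** With its lower end closed, [v] can be entered from [round_up v] only and left only towards it,
    so [v] is of use at most as the last vertex of the path. *)
Lemma dead_end n v w : ~~ in_V0_site v -> w (round_down v) = false ->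
  hitb 0 n.*2 (origin d) (upd w v true) = hitb 0 n.*2 (origin d) (upd w v false).
Proof.
move=> bv wv; apply: le_anti; apply/andP; split; last first.
  by apply: increasing_upd; apply: hits_increasing.
apply: ler_asbool => -[b Bb c1]; set w0 := masked (upd w v false) _.
have cl : upd w v true (round_down v) = false by rewrite upd_other // round_down_bond.
have [[_ cb]|[bv' cu]] : b != v /\ conn (@adj d) w0 (origin d) b \/
    b = v /\ conn (@adj d) w0 (origin d) (round_up v).
- move: b {Bb} c1; apply: conn_ind => [/andP[wo oo]|y z _ IH yz /andP[wz zb]].
    have ov : origin d != v.
      apply: contraNneq bv => <-; apply/even_rowP => i; by rewrite mxE.
    left; split => //; apply: conn_refl; rewrite /w0 /masked oo andbT.
    by move: wo; rewrite !upd_other.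
  have [zv|zv] := eqVneq z v.
    right; split => //; case: IH => [[yv cy]|[yv _]]; last first.
      by move: yz; rewrite zv yv /adj /= /dist_l1 big1 // => i _; rewrite subrr.
    subst z; have [<-//|yd] : y = round_up v \/ y = round_down v.
      by apply: adj_bond => //; rewrite adj_sym.
    have /andP[+ _] := conn_r cy.
    by rewrite yd upd_other ?round_down_bond // wv.
  left; split=> //.
  have w0z : w0 z by rewrite /w0 /masked zb andbT; move: wz; rewrite !upd_other.
  case: IH => [[_ cy]|[yv cu]]; first exact: conn_rcons cy yz w0z.
  subst y; have [->//|zd] := adj_bond bv yz.
  by move: wz; rewrite zd cl.
- by exists b.
(* If the path ends at [v] on the sphere, then by parity [round_up v] lies on the sphere already. *)
exists (round_up v) => //; rewrite bv' in Bb.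
have /andP[_ ub] := conn_r cu.
rewrite sphere_sub0 eqn_leq norm_even_attained // andbT -mem_box0.
exact: ub.
Qed.

Lemma abs_round_down (b : int) n :
  (`|b| <= n.*2)%N -> (`|(b - (odd `|b|%N)%:Z)%R| <= n.*2)%N.
Proof.
case: (boolP (odd `|b|%N)) => [ob bn|_]; last by rewrite subr0.
have {ob}bn : (`|b| < n.*2)%N.
  by rewrite ltn_neqAle bn andbT; apply: contraTneq ob => ->; rewrite odd_double.
have -> : (nat_of_bool true)%:Z = 1 by [].
by move: n.*2 bn => m; lia.
Qed.

(** A site is the lower end of at most one bond in each direction; this is the source of the
    exponent [d]. *)
Lemma count_round_down (L : seq (vertex d)) x : uniq L ->
  all (fun v => ~~ in_V0_site v) L ->
  (count (fun v => round_down v == x) L <= d)%N.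
Proof.
move=> uL bL; rewrite -size_filter -[leqRHS](size_enum_ord d).
rewrite -(size_map (fun i => insubd x (val x + delta_mx ord0 i))).
apply: uniq_leq_size; first by rewrite filter_uniq.
move=> v; rewrite mem_filter => /andP[/eqP vx vL].
have [i oi] := bond_odd (allP bL v vL).
apply/mapP; exists i; rewrite ?mem_enum //; apply: val_inj.
have e : val v = val x + delta_mx ord0 i.
  rewrite -vx val_round_down; apply/rowP => j; rewrite !mxE eqxx /=.
  have [->|ji] := eqVneq j i; first by rewrite oi subrK.
  rewrite (_ : odd _ = false) ?subr0 ?addr0 //.
  by apply/negP => oj; case/eqP: ji; apply: odd_coord_uniq oj oi.
by rewrite val_insubd -e (valP v).
Qed.

(* Each bond [v] is handed a factor [a] taken from the site [round_down v]. *)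
Lemma cross_swap n p q a : 0 <= p <= 1 -> 0 <= q <= 1 -> 0 <= a <= 1 ->
  cross d n.*2 p (q * a ^+ d) <= cross d n.*2 (p * a) q.
Proof.
move=> hp hq ha; have /andP[a0 a1] := ha; have /andP[p0 p1] := hp.
have /andP[q0 q1] := hq.
(* Interpolation: the bonds in [L] still have parameter [p], and each of them has cost its lower end
   site a factor [a]. Removing a bond from [L] is one application of [Ex_swap]. *)
pose r (L : seq (vertex d)) v : R :=
  if in_V0_site v then q * a ^+ count (fun b => round_down b == v) L
  else if v \in L then p else p * a.
have ak k : 0 <= a ^+ k <= 1 by rewrite exprn_ge0 // exprn_ile1.
have wr L : weight (r L).
  move=> v; rewrite /r; case: ifP => _; last case: ifP => // _.
    have /andP[b0 b1] := ak (count (fun b => round_down b == v) L).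
    by rewrite mulr_ge0 // mulr_ile1.
  by rewrite mulr_ge0 // mulr_ile1.
pose f := hitb 0 n.*2 (origin d); pose s := box (0 : 'rV[int]_d) n.*2.
have fi : increasing f by apply: hits_increasing.
have step L : uniq L -> all (fun v => ~~ in_V0_site v) L -> {subset L <= s} ->
    Ex (r L) s f (fun=> false) <= Ex (r [::]) s f (fun=> false).
  elim: L => [//|v L IH] /= /andP[vL uL] /andP[bv bL] Ls.
  apply: le_trans (IH uL bL _); last by move=> u uL'; apply: Ls; rewrite inE uL' orbT.
  have vs : v \in s by apply: Ls; rewrite mem_head.
  have sx : in_V0_site (round_down v) by apply: round_down_even.
  apply: (@Ex_swap R _ (r (v :: L)) (r L) s f (fun=> false) (round_down v) v a).
  - exact: box_uniq.
  - rewrite mem_box0 norm_le; apply/forallP => i.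
    move: vs; rewrite mem_box0 norm_le => /forallP/(_ i); rewrite val_round_down mxE.
    exact: abs_round_down.
  - exact: vs.
  - exact: round_down_bond.
  - exact: wr.
  - exact: ha.
  - exact: fi.
  - by move=> w; apply: dead_end.
  - by rewrite /r sx /= eqxx add1n exprS mulrCA.
  - by rewrite /r (negbTE bv) (negbTE vL) mem_head mulrC.
  - move=> u ux uv; rewrite /r /= inE (negbTE uv).
    by rewrite eq_sym (negbTE ux) add0n.
pose L := [seq v <- s | ~~ in_V0_site v].
have bL : all (fun v => ~~ in_V0_site v) L by apply: filter_all.
have uL : uniq L by rewrite filter_uniq // box_uniq.
apply: (@le_trans _ _ (Ex (r L) s f (fun=> false))).
  apply: Ex_le_weight => //.
    by apply: weight_occ => //; have /andP[b0 b1] := ak d; rewrite mulr_ge0 // mulr_ile1.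
  move=> v vs; rewrite /r /occ_prob; case: ifPn => sv.
    by rewrite ler_wpM2l // ler_wiXn2l // count_round_down.
  by rewrite mem_filter sv vs.
apply: le_trans (step L uL bL _) _; first by move=> v; rewrite mem_filter => /andP[].
rewrite /cross (eq_Ex_weight (rho' := occ_prob (p * a) q)) // => v _.
by rewrite /r /occ_prob /= mulr1.
Qed.

Lemma cross_full n : (0 < d)%N -> cross d n (1 : R) 1 = 1.
Proof.
(* The background may be taken all open; with all parameters equal to 1 this is the only
   configuration met. *)
move=> d0; rewrite /cross (Ex_background _ _ (fun=> true) (hits_depends (@adj d) R _ _)).
apply: (Ex_as (Q := fun w => w = fun=> true)) => //.
- by move=> u w _ ->; apply/funext => v; rewrite /upd; case: eqP.
- by move=> u w; rewrite /occ_prob if_same eqxx.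
move=> _ ->; rewrite /hits asboolT //.
pose i0 : 'I_d := Ordinal d0.
pose ax (k : nat) : 'rV[int]_d := \row_j (if j == i0 then k%:Z else 0).
have axV k : in_V (ax k).
  rewrite /in_V -(cards1 i0).
  apply: subset_leq_card; apply/fintype.subsetP => j; rewrite !inE mxE.
  by case: eqP.
pose v k : vertex d := Sub (ax k) (axV k).
have vn k : norm_infty (val (v k)) = k.
  apply/eqP; rewrite eqn_leq norm_le; apply/andP; split.
    by apply/forallP => j; rewrite mxE; case: eqP.
  by have := coord_le_norm (ax k) i0; rewrite mxE eqxx.
exists (v n); first by rewrite sphere_sub0 vn.
suff : forall k, (k <= n)%N ->
    conn (@adj d) (masked (fun=> true) (mem (box 0 n))) (origin d) (v k) by apply.
elim=> [|k IH] kn.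
  rewrite (_ : v 0%N = origin d); last first.
    by apply: val_inj; apply/rowP => j; rewrite !mxE if_same.
  by apply: conn_refl; rewrite /masked /= mem_box0 norm0.
apply: conn_rcons (IH (ltnW kn)) _ _; last by rewrite /masked /= mem_box0 vn.
rewrite /adj /= /dist_l1 (bigD1 i0) //= big1.
  by rewrite !mxE eqxx addn0; apply/eqP; lia.
by move=> j /negbTE ji; rewrite !mxE ji.
Qed.

(** With all bonds closed, the cluster of the origin in the unit ball is at most the origin, whose
    neighbours all lie in the ball; so [phi] vanishes. *)
Lemma finite_criterion0 q : finite_criterion d (0 : R) q.
Proof.
exists 2%N, (fun v => norm_infty (val v) <= 1)%N; split => //; first by rewrite norm0.
rewrite /phi big1 ?divr_gt0 // => y Sy.
apply: (Ex_as (Q := fun w => forall v, ~~ in_V0_site v -> w v = false)) => //.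
- move=> u w h Qw v bv; rewrite upd_other ?Qw //; apply: contraNneq h => vu.
  by rewrite /occ_prob -vu (negbTE bv).
- by move=> u w _ Qw v bv; rewrite /upd; case: eqP => // _; apply: Qw.
move=> w Qw; rewrite /exit asboolF // => -[x xy cx].
have /andP[wx Sx] := conn_r cx.
have sx : in_V0_site x by apply/negPn/negP => /Qw; rewrite wx.
case/negP: Sy; have := adj_norm 0 xy; rewrite !subr0.
have -> : norm_infty (val x) = 0%N; last by [].
apply/eqP; rewrite -leqn0 norm_le; apply/forallP => i.
have := even_rowP _ sx i; move: Sx; rewrite norm_le => /forallP/(_ i).
by move: `|_|%N => k; lia.
Qed.

End Coupling.

(** * From finite boxes to the infinite measure *)

Section Measure.
Context (R : realType) (d : nat).
Implicit Types (p q : R) (n : nat) (u v : vertex d) (w : config d).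

Section FixedParameters.
Variables (p q : R) (mu : probability (config d) R).
Hypothesis hmu : percolation_measure p q mu.
Let rho := @occ_prob R d p q.

Lemma measurable_state v b : measurable [set w : config d | state w v = b].
Proof. by apply: sub_sigma_algebra; exists v, b. Qed.

Lemma measure_state v b :
  mu [set w | state w v = b] = (if b then rho v else 1 - rho v)%:E.
Proof.
case: b; first exact: hmu.2.
have -> : [set w | state w v = false] = ~` [set w : config d | state w v = true].
  by apply/seteqP; split => w /=; case: (state w v).
rewrite probability_setC; last exact: measurable_state.
by rewrite [X in (_ - X)%E](hmu.2 v) EFinB.
Qed.

Definition agree (r : seq (vertex d)) (w0 : vertex d -> bool) : set (config d) :=
  [set w | forall v, v \in r -> w0 v = state w v].

Lemma measurable_agree r w0 : measurable (agree r w0).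
Proof.
elim: r => [|v r IH].
  by rewrite (_ : agree _ _ = setT) //; apply/seteqP; split => w.
have -> : agree (v :: r) w0 = [set w | state w v = w0 v] `&` agree r w0.
  apply/seteqP; split => w /=.
    move=> h; split; first by rewrite h ?mem_head.
    by move=> u ur; apply: h; rewrite inE ur orbT.
  by move=> [hv hr] u; rewrite inE => /orP[/eqP -> //|]; apply: hr.
by apply: measurableI => //; apply: measurable_state.
Qed.

Lemma measure_agree r w0 : uniq r ->
  mu (agree r w0) = (\prod_(v <- r) (if w0 v then rho v else 1 - rho v))%:E.
Proof.
move=> ur; have := hmu.1 r (fun v => [set b | w0 v = b]) ur.
rewrite /agree /= => ->; rewrite -prodEFin; apply: eq_bigr => v _.
rewrite -measure_state; congr (mu _).
by apply/seteqP; split => w.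
Qed.

(** The bridge between the measure and [Ex]: vertices of [r] are frozen to [w0], those of [s] are
    averaged, and the induction moves one vertex from [s] to [r] by splitting on its state. *)
Lemma cylinder s r (E : (vertex d -> bool) -> Prop) w0 : uniq (s ++ r) ->
  depends_on (fun v => v \in s ++ r) E ->
  let A := agree r w0 `&` [set w | E (state w)] in
  measurable A /\
  mu A = ((\prod_(v <- r) (if w0 v then rho v else 1 - rho v)) *
          Ex rho s (fun w => `[< E w >]%:R) w0)%:E.
Proof.
elim: s r w0 => [|v s IH] r w0.
  move=> ur Er A; have {A}-> : A = if `[< E w0 >] then agree r w0 else set0.
    apply/seteqP; split=> w; case: asboolP => //= E0.
    - by case.
    - by move=> [ww' Ew]; apply: E0; rewrite (Er _ _ ww').
    - by move=> ww'; split => //=; rewrite -(Er _ _ ww').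
  rewrite /=; case: asboolP => _; last by rewrite measure0 mulr0; split.
  by rewrite mulr1 measure_agree //; split => //; apply: measurable_agree.
move=> us Es A.
have pe : perm_eq ((v :: s) ++ r) (s ++ v :: r).
  by rewrite perm_sym perm_catC /= perm_cons perm_catC.
have us' : uniq (s ++ v :: r) by rewrite -(perm_uniq pe).
have Es' : depends_on (fun u => u \in s ++ v :: r) E.
  by move=> w w' h; apply: Es => u; rewrite (perm_mem pe); apply: h.
have vr : v \notin r by move: us => /= /andP[]; rewrite mem_cat negb_or => /andP[].
have [m1 e1] := IH (v :: r) (upd w0 v true) us' Es'.
have [m0 e0] := IH (v :: r) (upd w0 v false) us' Es'.
have split_b b w : agree (v :: r) (upd w0 v b) w <-> agree r w0 w /\ state w v = b.
  split=> [h|[h hv] u].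
    split; last by rewrite -h ?mem_head // upd_same.
    move=> u ur; have <- := h u; last by rewrite inE ur orbT.
    by rewrite upd_other //; apply: contraNneq vr => <-.
  rewrite inE /upd; case: eqP => [-> _|_ /=]; first by rewrite hv.
  exact: h.
have -> : A = (agree (v :: r) (upd w0 v true) `&` [set w | E (state w)]) `|`
              (agree (v :: r) (upd w0 v false) `&` [set w | E (state w)]).
  apply/seteqP; split => w /=.
    move=> [ar Ew]; case wv : (state w v); [left|right]; split => //;
    by apply/split_b.
  by move=> [] [/split_b[]].
split; first exact: measurableU.
have dis : (agree (v :: r) (upd w0 v true) `&` [set w | E (state w)]) `&`
           (agree (v :: r) (upd w0 v false) `&` [set w | E (state w)]) = set0.
  apply/seteqP; split => w //= [[/split_b[_ wt] _] [/split_b[_ wf] _]].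
  by rewrite wt in wf.
rewrite (measureU mu m1 m0 dis).
have prod_upd b : \prod_(u <- r) (if upd w0 v b u then rho u else 1 - rho u) =
    \prod_(u <- r) (if w0 u then rho u else 1 - rho u).
  rewrite big_seq [RHS]big_seq; apply: eq_bigr => u ur.
  by rewrite upd_other //; apply: contraNneq vr => <-.
rewrite [X in (X + _)%E]e1 [X in (_ + X)%E]e0.
rewrite !big_cons !upd_same !prod_upd -EFinD /=; congr (_%:E).
by rewrite -/rho; ring.
Qed.

Definition arm n w :=
  exists2 b, sphere 0 n b & conn (@adj d) (masked w (mem (box 0 n))) (origin d) b.

Lemma arm_cross n : measurable [set w | arm n w] /\
  mu [set w | arm n w] = (cross d n p q)%:E.
Proof.
have := @cylinder (box 0 n) [::] (arm n) (fun=> false).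
rewrite cats0 box_uniq => /(_ isT) [].
  move=> w w' h; rewrite /arm (_ : masked w _ = masked w' (mem (box 0 n))) //.
  by apply/funext => v; rewrite /masked /=; case: (boolP (v \in _)) => [/h ->|]; rewrite ?andbF.
rewrite big_nil mul1r (_ : agree _ _ = setT); last by apply/seteqP; split.
by rewrite setTI.
Qed.

Lemma arm_mono n N w : (n <= N)%N -> arm N w -> arm n w.
Proof.
move=> nN [b]; rewrite sphere_sub0 => /eqP bN cb.
have [|b' Bb' cb'] := conn_sphere (n := n) cb; first by rewrite subr0 bN.
exists b' => //; apply: conn_mono cb' => v /andP[/andP[wv _] vb].
by rewrite /masked wv.
Qed.

Lemma connected_to_arm n w : (0 < n)%N ->
  connected_to w (origin d) (boundary_box d n) <-> arm n w.
Proof.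
move=> n0; split=> [[y yn [oy|cy]]|[b]].
- by move: yn n0; rewrite /boundary_box /= -oy norm0 => <-.
- by apply: (conn_sphere cy); rewrite subr0 yn.
rewrite sphere_sub0 => /eqP bn cb; exists b => //; right.
by apply: conn_mono cb => v /andP[].
Qed.

Lemma connected_to_infty_arm : [set w | connected_to_infty w (origin d)] =
  \bigcap_n [set w | arm n w].
Proof.
apply/seteqP; split => w /=.
  move=> wi n _ /=; have [y [cy ny]] : exists y, occ_connected w (origin d) y /\
      (n <= norm_infty (val y))%N.
    apply: contrapT => h; apply: wi; apply: sub_finite_set (finite_seq (box 0 n)).
    move=> y /= cy; rewrite mem_box0 leqNgt; apply/negP => ny; apply: h.
    by exists y; split => //; apply: ltnW.
  by apply: (conn_sphere cy); rewrite subr0.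
move=> wa /finite_seqP[s hs].
have [b] := wa (\max_(v <- s) norm_infty (val v)).+1 I.
rewrite sphere_sub0 => /eqP bn cb; have bs : b \in s.
  have : [set y | occ_connected w (origin d) y] b.
    by apply: conn_mono cb => v /andP[].
  by rewrite hs.
by have := @leq_bigmax_seq _ s xpredT (fun v => norm_infty (val v)) b bs isT; rewrite bn ltnn.
Qed.

Lemma theta_le_cross n : (mu [set w | connected_to_infty w (origin d)] <= (cross d n p q)%:E)%E.
Proof.
have [mn <-] := arm_cross n; rewrite connected_to_infty_arm.
apply: le_measure; rewrite ?inE //.
  by apply: bigcap_measurable => // k _; have [] := arm_cross k.
by move=> w; apply.
Qed.

(** Continuity from above; arm events decrease with the radius, so a bound along arbitrarily large
    radii is enough. *)
Lemma le_theta (c : R) : (forall n, exists2 m, (n <= m)%N & c <= cross d m p q) ->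
  (c%:E <= mu [set w | connected_to_infty w (origin d)])%E.
Proof.
move=> hc; rewrite connected_to_infty_arm.
have cv : mu \o (fun n => [set w : config d | arm n w]) @ \oo -->
    mu (\bigcap_n [set w : config d | arm n w]).
  apply: nonincreasing_cvg_mu.
  - by rewrite (le_lt_trans (probability_le1 _ _)) ?ltry //; have [] := arm_cross 0.
  - by move=> n; have [] := arm_cross n.
  - by apply: bigcap_measurable => // k _; have [] := arm_cross k.
  - by move=> n m nm; apply/subsetPset => w /=; apply: arm_mono.
apply: (cvge_ge _ cv); apply: nearW => n /=; have [m nm cm] := hc n.
have [mn _] := arm_cross n; have [mm e] := arm_cross m.
apply: (@le_trans _ _ (mu [set w | arm m w])); first by rewrite e lee_fin.
by apply: le_measure; rewrite ?inE // => w; apply: arm_mono.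
Qed.

End FixedParameters.
End Measure.

(** * The phase diagram *)

Lemma bernoulli_ineq (R : realDomainType) (x : R) n : 0 <= x <= 1 -> 1 - n%:R * x <= (1 - x) ^+ n.
Proof.
move=> /andP[x0 x1]; elim: n => [|n IH]; first by rewrite mul0r subr0.
have y1 : (1 - x) ^+ n <= 1 by rewrite exprn_ile1 ?subr_ge0 // gerBl.
rewrite exprS -natr1; move: ((1 - x) ^+ n) y1 IH => y y1 IH; nra.
Qed.

Section Phases.
Context (R : realType) (d : nat) (hd : (0 < d)%N).
Variables (P : R -> R -> probability (config d) R) (hP : percolation_family P).
Implicit Types (p q a t : R).

Notation crit := (@finite_criterion R d).

Lemma theta_le p q n : 0 <= p <= 1 -> 0 <= q <= 1 ->
  (theta P p q <= (cross d n p q)%:E)%E.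
Proof. by move=> hp hq; apply: theta_le_cross (hP hp hq) n. Qed.

(** Stated along arbitrarily large radii because some comparisons are available at even radii
    only. *)
Lemma theta_gt0P p q : 0 <= p <= 1 -> 0 <= q <= 1 ->
  (0 < theta P p q)%E <->
  exists2 c, 0 < c & forall n, exists2 m, (n <= m)%N & c <= cross d m p q.
Proof.
move=> hp hq; split=> [h|[c c0 hc]]; last first.
  by apply: lt_le_trans (le_theta (hP hp hq) hc); rewrite lte_fin.
have fin : theta P p q \is a fin_num.
  by rewrite ge0_fin_numE ?measure_ge0 // (le_lt_trans (theta_le 0 hp hq)) ?ltry.
exists (fine (theta P p q)); first by rewrite fine_gt0 // h -ge0_fin_numE ?measure_ge0 // fin.
by move=> n; exists n => //; rewrite -lee_fin fineK //; apply: theta_le.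
Qed.

Lemma theta_eq0P p q : theta P p q = 0%E <-> ~ (0 < theta P p q)%E.
Proof.
split=> [->|/negP]; first by rewrite ltxx.
by rewrite -leNgt => h; apply/eqP; rewrite eq_le h measure_ge0.
Qed.

Lemma theta_gt0_neq0 p q : (0 < theta P p q)%E -> theta P p q <> 0%E.
Proof. by move=> h /theta_eq0P. Qed.

Lemma theta_gt0_le p q p' q' : 0 <= p <= 1 -> 0 <= q <= 1 ->
  0 <= p' <= 1 -> 0 <= q' <= 1 ->
  (forall n, cross d n.*2 p q <= cross d n.*2 p' q') ->
  (0 < theta P p q)%E -> (0 < theta P p' q')%E.
Proof.
move=> hp hq hp' hq' h /(theta_gt0P hp hq)[c c0 hc]; apply/(theta_gt0P hp' hq').
exists c => // n; have [m nm cm] := hc n.*2; exists n.*2; first by rewrite -addnn leq_addr.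
by apply: le_trans (h n); apply: le_trans cm _; apply: cross_nincr.
Qed.

Lemma theta_gt0_mono p q p' q' : 0 <= p <= 1 -> 0 <= q <= 1 ->
  0 <= p' <= 1 -> 0 <= q' <= 1 -> p <= p' -> q <= q' ->
  (0 < theta P p q)%E -> (0 < theta P p' q')%E.
Proof. by move=> *; apply: (@theta_gt0_le p q) => // n; apply: cross_mono. Qed.

Lemma mul_unit p a : 0 <= p <= 1 -> 0 <= a <= 1 -> 0 <= p * a <= 1.
Proof. by move=> /andP[? ?] /andP[? ?]; rewrite mulr_ge0 // mulr_ile1. Qed.

Lemma exp_unit a n : 0 <= a <= 1 -> 0 <= a ^+ n <= 1.
Proof. by move=> /andP[? ?]; rewrite exprn_ge0 // exprn_ile1. Qed.

Lemma theta_gt0_swap p q a : 0 <= p <= 1 -> 0 <= q <= 1 -> 0 <= a <= 1 ->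
  (0 < theta P p (q * a ^+ d))%E -> (0 < theta P (p * a) q)%E.
Proof.
move=> hp hq ha; apply: theta_gt0_le => //; try apply: mul_unit => //.
  exact: exp_unit.
by move=> n; apply: cross_swap.
Qed.

Lemma crit_theta0 p q : 0 <= p <= 1 -> 0 <= q <= 1 -> crit p q -> theta P p q = 0%E.
Proof.
move=> hp hq /(cross_geometric hp hq)[a [m [/andP[a0 a1] m0 ha]]].
apply/theta_eq0P => /(theta_gt0P hp hq)[c c0 hc].
have [k _ hk] : \forall k \near \oo, a ^+ k < c.
  have : (fun k => a ^+ k) @ \oo --> (0 : R) by apply: cvg_expr; rewrite gtr0_norm.
  by move/cvgr_lt; apply.
have [n kn cn] := hc (k * m)%N; have := hk k (leqnn k); apply/negP; rewrite -leNgt.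
apply: le_trans cn _; apply: le_trans (ha n) _.
by rewrite ler_wiXn2l ?ltW // leq_divRL.
Qed.

Lemma sprinkle_unit p t : 0 <= p <= 1 -> 0 < t < 1 -> 0 <= 1 - t * (1 - p) <= 1.
Proof. move=> /andP[p0 p1] /andP[t0 t1]; apply/andP; split; nra. Qed.

Lemma theta_sprinkle p q t : 0 <= p <= 1 -> 0 <= q <= 1 -> 0 < t < 1 -> ~ crit p q ->
  (0 < theta P (1 - t * (1 - p)) (1 - t * (1 - q)))%E.
Proof.
move=> hp hq ht nC; have /andP[t0 t1] := ht.
apply/theta_gt0P; try exact: sprinkle_unit.
exists ((1 - t) / 2) => [|n]; first by rewrite divr_gt0 // subr_gt0.
by exists n => //; apply: cross_sprinkle => //; rewrite t0 ltW.
Qed.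

Lemma crit_decay p q : 0 <= p <= 1 -> 0 <= q <= 1 -> crit p q ->
  exists c : R, 0 < c /\
    \forall n \near \oo, (theta_n P n p q <= (expR (- (c * n%:R)))%:E)%E.
Proof.
move=> hp hq /(cross_geometric hp hq)[a [m [/andP[a0 a1] m0 ha]]].
have la : ln a < 0 by rewrite ln_lt0 // a0.
have m0' : 0 < (m%:R : R) by rewrite ltr0n.
(* For [n >= m] the integer quotient of [n] by [m] is at least [n / (2 m)], which accounts for the
   2. *)
exists (- ln a / (2 * m%:R)); split; first by rewrite divr_gt0 ?oppr_gt0 // mulr_gt0.
exists m => // n /= mn; rewrite /theta_n.
have n0 : (0 < n)%N := leq_trans m0 mn.
have -> : [set w | connected_to w (origin d) (boundary_box d n)] = [set w : config d | arm n w].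
  by apply/seteqP; split => w /=; move/(connected_to_arm w n0).
have [_ ->] := arm_cross (hP hp hq) n; rewrite lee_fin; apply: le_trans (ha n) _.
rewrite -{1}(lnK a0) -expRM_natr ler_expR.
have hk : n%:R <= 2 * m%:R * ((n %/ m)%:R : R).
  rewrite -!natrM ler_nat; have k1 : (0 < n %/ m)%N by rewrite divn_gt0.
  have := ltn_pmod n m0; have := divn_eq n m; move: (n %/ m)%N (n %% m)%N k1 => k r; nia.
have -> : - (- ln a / (2 * m%:R) * n%:R) = ln a * (n%:R / (2 * m%:R)).
  by field; rewrite gt_eqF.
rewrite ler_wnM2l ?(ltW la) //.
by rewrite ler_pdivrMr ?mulr_gt0 // mulrC.
Qed.

(** For fixed [m] and [S], [phi] is a continuous function of the two parameters, so the good points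
    form a union of open sets. *)
Lemma crit_open : open [set x : R * R | crit x.1 x.2].
Proof.
have -> : [set x : R * R | crit x.1 x.2] =
  \bigcup_(i in [set i : nat * (vertex d -> bool) |
                  i.2 (origin d) /\ forall v, i.2 v -> (norm_infty (val v) < i.1)%N])
    ((fun x : R * R => phi (@adj d) (occ_prob x.1 x.2) (box 0 i.1) i.2 (origin d))
       @^-1` [set y | y < 1 / 2]).
  apply/seteqP; split => x; first by move=> [m [S [So Sm h]]]; exists (m, S).
  by move=> [[m S] /= [So Sm] h]; exists m, S.
apply: bigcup_open => -[m S] _; apply: open_comp; last exact: open_lt.
move=> x _ /=; rewrite /phi; apply: continuous_big => [|y _]; first exact: add_continuous.
apply: (Ex_continuous (r := fun v (x : R * R) => occ_prob x.1 x.2 v)) => v z.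
by rewrite /occ_prob; case: (in_V0_site v); [exact: cvg_snd|exact: cvg_fst].
Qed.

Lemma crit_nbhs p q : crit p q -> exists2 e : R, 0 < e &
  forall p' q', `|p - p'| < e -> `|q - q'| < e -> crit p' q'.
Proof.
move=> c; have : nbhs (p, q) [set x : R * R | crit x.1 x.2].
  by apply: open_nbhs_nbhs; split; [exact: crit_open|].
by move=> /nbhs_ballP[e e0 h]; exists e => // p' q' hp hq; apply: (h (p', q')).
Qed.

Lemma unit1 : 0 <= (1 : R) <= 1. Proof. by rewrite ler01 lexx. Qed.

Lemma theta11 : (0 < theta P 1 1)%E.
Proof.
apply/(theta_gt0P unit1 unit1); exists 1 => // n; exists n => //.
by rewrite cross_full.
Qed.

(** * Critical values and their relation to good points *)

Let A := [set p : R | 0 <= p <= 1 /\ (0 < theta P p 1)%E].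

Lemma A1 : A 1. Proof. by split; [exact: unit1|exact: theta11]. Qed.

Lemma A_lb : has_lbound A.
Proof. by exists 0 => p [/andP[]]. Qed.

Lemma pc0_le p : 0 <= p <= 1 -> (0 < theta P p 1)%E -> pc0 P <= p.
Proof. by move=> hp h; apply: ge_inf A_lb _ _; split. Qed.

Lemma pc0_ge0 : 0 <= pc0 P.
Proof. by apply: lb_le_inf; [exists 1; exact: A1|move=> p [/andP[]]]. Qed.

Lemma pc0_le1 : pc0 P <= 1.
Proof. by apply: pc0_le; [exact: unit1|exact: theta11]. Qed.

Lemma pc0_lt p : 0 <= p <= 1 -> pc0 P < p -> (0 < theta P p 1)%E.
Proof.
move=> hp pp; have [|p' [hp' h] pp'] := inf_lt _ pp; first by exists 1; exact: A1.
by apply: theta_gt0_mono h => //; [exact: unit1|exact: unit1|exact: ltW].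
Qed.

Lemma le_qc p q : 0 <= q <= 1 -> theta P p q = 0%E -> q <= qc P p.
Proof. by move=> hq h; apply: ub_le_sup; [exists 1 => x [/andP[]]|split]. Qed.

Lemma qc_lt p q : 0 <= q <= 1 -> qc P p < q -> (0 < theta P p q)%E.
Proof.
move=> hq h; apply: contrapT => /theta_eq0P/(le_qc hq).
by rewrite leNgt h.
Qed.

Lemma lt_qc p q : 0 <= q -> q < qc P p ->
  exists q', [/\ q < q', q' <= 1 & theta P p q' = 0%E].
Proof.
move=> q0 h; set B := [set q : R | 0 <= q <= 1 /\ theta P p q = 0%E].
have [B0|/set0P B0] := eqVneq B set0.
  by move: h; rewrite /qc -/B B0 sup0 ltNge q0.
by have [q' [/andP[_ q1] hq'] qq'] := sup_gt B0 h; exists q'.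
Qed.

Lemma qc_ge0 p : 0 <= qc P p.
Proof.
rewrite /qc; set B := [set q : R | _].
have [->|/set0P[q Bq]] := eqVneq B set0; first by rewrite sup0.
have [/andP[q0 _] hq] := Bq; apply: le_trans q0 _.
by apply: le_qc; case: Bq.
Qed.

Lemma qc_le1 p : qc P p <= 1.
Proof.
rewrite /qc; set B := [set q : R | _].
have [->|/set0P B0] := eqVneq B set0; first by rewrite sup0.
by apply: ge_sup => // q [/andP[]].
Qed.

Lemma crit_lt_pc0 p q : 0 <= p <= 1 -> 0 <= q <= 1 -> p < pc0 P -> crit p q.
Proof.
move=> hp hq pp; have /andP[p0 p1] := hp; have /andP[q0 q1] := hq.
apply: (@finite_criterion_mono _ _ p q p 1) => //; first exact: unit1.
apply: contrapT => nC; have pc1 := pc0_le1.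
(* Sprinkling then raises [p] by at most half its distance to [pc0 P], yet it would produce
   percolation. *)
pose t := 1 - (pc0 P - p) / 2; have ht : 0 < t < 1 by rewrite /t; apply/andP; split; lra.
have := theta_sprinkle hp unit1 ht nC; rewrite subrr mulr0 subr0.
move/(pc0_le (sprinkle_unit hp ht)); rewrite /t; nra.
Qed.

(** Goodness survives a small increase of the parameters and forces [theta] to vanish. Raising [q]
    places it strictly below [qc P p]; if [q] is 1, raising [p] above [pc0 P] gives a
    contradiction. *)
Lemma crit_subcritical p q : 0 <= p <= 1 -> 0 <= q <= 1 -> crit p q ->
  p < pc0 P \/ pc0 P <= p /\ q < qc P p.
Proof.
move=> hp hq c; have [|pp] := ltP p (pc0 P); [by left|right; split => //].
have [e e0 he] := crit_nbhs c; have /andP[p0 p1] := hp; have /andP[q0 q1] := hq.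
pose up (x : R) := Num.min 1 (x + e / 2).
have upE x : 0 <= x <= 1 -> [/\ 0 <= up x <= 1, `|x - up x| < e & x < 1 -> x < up x].
  move=> /andP[x0 x1]; rewrite /up /Num.min; case: ltP => h.
    by split=> //; [exact: unit1|rewrite ltr_distl; apply/andP; split; lra].
  by split; [lra|rewrite ltr_distl; apply/andP; split; lra|lra].
have nee (x : R) : `|x - x| < e by rewrite subrr normr0.
have [hu1 hu2 hu3] := upE q hq; have [hv1 hv2 hv3] := upE p hp.
have [q_lt1|q_ge1] := ltP q 1.
  apply: lt_le_trans (hu3 q_lt1) _; apply: le_qc => //.
  by apply: crit_theta0 => //; apply: he.
have q_1 : q = 1 by apply/eqP; rewrite eq_le q1.
subst q; exfalso; have [p_lt1|p_ge1] := ltP p 1.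
  have : (0 < theta P (up p) 1)%E by apply: pc0_lt => //; apply: le_lt_trans (hv3 p_lt1).
  by apply/theta_eq0P; apply: crit_theta0 => //; apply: he.
have p_1 : p = 1 by apply/eqP; rewrite eq_le p1.
by subst p; have := theta11; apply/theta_eq0P; apply: crit_theta0.
Qed.

Lemma pc0_gt0 : 0 < pc0 P.
Proof.
have unit0 : 0 <= (0 : R) <= 1 by rewrite lexx ler01.
have [//|[_]] := crit_subcritical unit0 unit1 (finite_criterion0 d 1).
by rewrite ltNge qc_le1.
Qed.

(** A point [(p, q')] with [q'] above [q] and zero [theta] is traded for a point without percolation
    that exceeds [(p, q)] in both coordinates. If [(p, q)] were not good, a small sprinkling would
    percolate below that point. *)
Lemma crit_lt_qc p q : 0 <= p <= 1 -> 0 <= q <= 1 -> pc0 P <= p -> q < qc P p -> crit p q.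
Proof.
move=> hp hq pp; have /andP[_ p1] := hp; have /andP[q0 q1] := hq.
have p0 : 0 < p := lt_le_trans pc0_gt0 pp.
move=> /(lt_qc q0)[q' [qq' q'1 h0]]; apply: contrapT => nC.
have hq' : 0 <= q' <= 1 by rewrite q'1 (le_trans q0) // ltW.
have [p_lt1|p_ge1] := ltP p 1; last first.
  have p_1 : p = 1 by apply/eqP; rewrite eq_le p1.
  subst p; pose t := 1 - (q' - q) / 2.
  have ht : 0 < t < 1 by rewrite /t; apply/andP; split; lra.
  have := theta_sprinkle hp hq ht nC; rewrite subrr mulr0 subr0 => h.
  move: h0; apply: theta_gt0_neq0.
  by apply: theta_gt0_mono h => //; [exact: sprinkle_unit|rewrite /t; nra].
have d0 : 0 < (d%:R : R) by rewrite ltr0n.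
have d1 : 1 <= (d%:R : R) by rewrite ler1n.
(* Small enough that [p + eta <= 1] and that, by Bernoulli's inequality, the factor [a ^+ d] uses up
   at most half of the gap between [q] and [q']. *)
pose eta := Num.min (1 - p) (p * ((q' - q) / (2 * d%:R))).
have [eta0 eta1 eta2] : [/\ 0 < eta, eta <= 1 - p & eta <= p * ((q' - q) / (2 * d%:R))].
  have e0 : 0 < p * ((q' - q) / (2 * d%:R)).
    by rewrite mulr_gt0 // divr_gt0 ?subr_gt0 // mulr_gt0.
  have e1 : 0 < 1 - p by rewrite subr_gt0.
  by split; [rewrite lt_min e1 e0|rewrite ge_min lexx|rewrite ge_min lexx orbT].
pose p1' := p + eta; pose a := p / p1'.
have p1'0 : 0 < p1' by rewrite /p1'; lra.
have ha : 0 <= a <= 1.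
  by rewrite /a divr_ge0 ?(ltW p0) ?(ltW p1'0) //= ler_pdivrMr // mul1r /p1'; lra.
have aE : p1' * a = p by rewrite /a mulrC divfK // gt_eqF.
have hp1' : 0 <= p1' <= 1 by rewrite /p1'; apply/andP; split; lra.
have ha' : q < q' * a ^+ d /\ (q' - q) / 2 <= q' * a ^+ d - q.
  have xa : 0 <= 1 - a <= 1 by have /andP[a0 a1] := ha; apply/andP; split; lra.
  have := bernoulli_ineq d xa; rewrite subKr => hb.
  have ex : d%:R * (1 - a) <= (q' - q) / 2.
    have e1 : p1' * (1 - a) = eta by rewrite mulrBr mulr1 aE /p1'; ring.
    have e2 : p * (1 - a) <= eta.
      by have /andP[xa0 _] := xa; rewrite -e1 ler_wpM2r // /p1'; lra.
    have e3 : 1 - a <= (q' - q) / (2 * d%:R).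
      by rewrite -(ler_pM2l p0); apply: le_trans e2 eta2.
    rewrite -(ler_pM2l d0) in e3; apply: le_trans e3 _.
    by rewrite le_eqVlt; apply/orP; left; apply/eqP; field; rewrite gt_eqF.
  have /andP[q'0 _] := hq'.
  move: (a ^+ d) (d%:R * (1 - a)) hb ex => y x hb ex; split; nra.
have [hq1 hq2] := ha'.
have th0 : theta P p1' (q' * a ^+ d) = 0%E.
  apply/theta_eq0P => /(theta_gt0_swap hp1' hq' ha); rewrite aE.
  exact/theta_eq0P.
(* Sprinkling raises each parameter by at most [x], which fits in both gaps left by the trade. *)
pose x := Num.min eta ((q' - q) / 2).
have [x0 x1 x2] : [/\ 0 < x, x <= eta & x <= (q' - q) / 2].
  have e0 : 0 < (q' - q) / 2 by lra.
  by split; [rewrite lt_min eta0 e0|rewrite ge_min lexx|rewrite ge_min lexx orbT].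
pose t := 1 - x; have ht : 0 < t < 1 by rewrite /t; apply/andP; split; lra.
have := theta_sprinkle hp hq ht nC => h; move: th0; apply: theta_gt0_neq0.
apply: theta_gt0_mono h => //; try exact: sprinkle_unit.
- by apply: mul_unit => //; exact: exp_unit.
- by rewrite /t /p1'; nra.
- by rewrite /t; nra.
Qed.

Lemma subcriticalE : subcritical_set P = unit_square `&` [set x | crit x.1 x.2].
Proof.
apply/seteqP; split => -[p q] [[hp hq] /= h]; split => //=.
  by case: h => [|[]]; [exact: crit_lt_pc0|exact: crit_lt_qc].
exact: crit_subcritical.
Qed.

(** A union of open quadrants based at percolating points, which makes openness visible. The direct
    inclusion needs such a point strictly below and to the left, and the trade provides it. *)
Lemma supercriticalE : supercritical_set P = unit_square `&`
  \bigcup_(y in [set y | unit_square y /\ pc0 P <= y.1 /\ (0 < theta P y.1 y.2)%E])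
    [set x | y.1 < x.1 /\ y.2 < x.2].
Proof.
apply/seteqP; split => -[p q] [[hp hq] /=]; last first.
  move=> [[p' q'] /= [[hp' hq'] [pp' h]] [ltp ltq]]; split => //=; split.
    exact: le_lt_trans pp' ltp.
  have h' : (0 < theta P p q')%E by apply: theta_gt0_mono h => //; exact: ltW.
  rewrite ltNge; apply/negP => qq.
  have q'qc : q' < qc P p by apply: lt_le_trans ltq qq.
  have /andP[q'0 _] := hq'.
  have [q'' [l1 l2 h0]] := lt_qc q'0 q'qc.
  move: h0; apply: theta_gt0_neq0; apply: theta_gt0_mono h' => //; last exact: ltW.
  by rewrite l2 (le_trans _ (ltW l1)) //; case/andP: hq'.
move=> [pp qq]; rewrite /= in hp hq; split => //; have /andP[p0 p1] := hp; have /andP[q0 q1] := hq.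
have qc0 := qc_ge0 p; have pc00 := pc0_ge0.
(* Percolation holds at [(p, q1')]; the gap between [q1'] and [q2] pays for lowering [p], and [q2]
   stays below [q]. *)
pose q1' := (qc P p + q) / 2; pose q2 := (q1' + q) / 2.
have hq1' : 0 <= q1' <= 1 by rewrite /q1'; apply/andP; split; lra.
have hq2 : 0 <= q2 <= 1 by rewrite /q2 /q1'; apply/andP; split; lra.
have h1 : (0 < theta P p q1')%E by apply: qc_lt => //; rewrite /q1'; lra.
have d0 : 0 < (d%:R : R) by rewrite ltr0n.
pose x := Num.min (p - pc0 P) ((q2 - q1') / d%:R).
have [x0 x1 x2] : [/\ 0 < x, x <= p - pc0 P & x <= (q2 - q1') / d%:R].
  have e0 : 0 < (q2 - q1') / d%:R by rewrite divr_gt0 // /q2 /q1'; lra.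
  have e1 : 0 < p - pc0 P by rewrite subr_gt0.
  by split; [rewrite lt_min e1 e0|rewrite ge_min lexx|rewrite ge_min lexx orbT].
pose a := 1 - x.
have hx : 0 <= x <= 1 by apply/andP; split; lra.
have ha : 0 <= a <= 1 by rewrite /a; apply/andP; split; lra.
have hpa := mul_unit hp ha.
have aq : q1' <= q2 * a ^+ d.
  have := bernoulli_ineq d hx; rewrite -/a => hb.
  have ex : d%:R * x <= q2 - q1' by rewrite mulrC -ler_pdivlMr.
  have /andP[q20 q21] := hq2.
  have z0 : 0 <= d%:R * x * (1 - q2) by rewrite !mulr_ge0 ?(ltW d0) ?(ltW x0) // subr_ge0.
  by apply: le_trans (ler_wpM2l q20 hb); lra.
exists (p * a, q2) => /=; last first.
  have p_gt0 : 0 < p := le_lt_trans pc00 pp.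
  by split; [rewrite /a; nra|rewrite /q2 /q1'; lra].
split=> //; split; first by rewrite /a; nra.
apply: theta_gt0_swap => //; apply: theta_gt0_mono h1 => //.
by apply: mul_unit => //; exact: exp_unit.
Qed.

Lemma supercritical_open : relatively_open unit_square (supercritical_set P).
Proof.
eexists; last exact: supercriticalE.
apply: bigcup_open => -[p q] _ /=.
rewrite (_ : [set x | _] = fst @^-1` [set x : R | p < x] `&` snd @^-1` [set x : R | q < x]) //.
by apply: openI; apply: open_comp; try exact: open_gt => x _;
  move=> [x y] _; [exact: cvg_fst|exact: cvg_snd].
Qed.

(** Otherwise percolation at [pc0 P] for some [q] below 1 could be traded for percolation at [q = 1]
    with a bond parameter below [pc0 P]. *)
Lemma qc_pc0 : qc P (pc0 P) = 1.
Proof.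
have p0 := pc0_gt0; have p1 := pc0_le1.
have hp : 0 <= pc0 P <= 1 by rewrite (ltW p0).
apply/eqP; rewrite eq_le qc_le1 /= leNgt; apply/negP => h.
have qc0 := qc_ge0 (pc0 P); have d0 : 0 < (d%:R : R) by rewrite ltr0n.
have d1 : 1 <= (d%:R : R) by rewrite ler1n.
pose x := (1 - qc P (pc0 P)) / (2 * d%:R).
have x0 : 0 < x by rewrite /x divr_gt0 ?mulr_gt0 // subr_gt0.
have dx : d%:R * x = (1 - qc P (pc0 P)) / 2 by rewrite /x; field; rewrite gt_eqF.
have x1 : x <= 1 by nra.
have hx : 0 <= x <= 1 by rewrite (ltW x0).
have ha : 0 <= 1 - x <= 1 by apply/andP; split; lra.
have : (0 < theta P (pc0 P) (1 * (1 - x) ^+ d))%E.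
  rewrite mul1r; apply: qc_lt; first exact: exp_unit.
  by apply: lt_le_trans (bernoulli_ineq d hx); rewrite dx; lra.
move/(theta_gt0_swap hp unit1 ha)/(pc0_le (mul_unit hp ha)); nra.
Qed.

End Phases.

(** * Paths through the phase diagram, and conclusion *)

Lemma path_near (R : realType) (T : topologicalType) (gamma : R -> T) (O : set T) (tc : R) :
  {within `[0, 1], continuous gamma} -> 0 < tc < 1 -> open O -> O (gamma tc) ->
  exists2 e : R, 0 < e & forall t, `|tc - t| < e -> 0 <= t <= 1 -> O (gamma t).
Proof.
move=> cg /andP[t0 t1] oO Otc.
have tc01 : `[0, 1]%classic tc by rewrite /= in_itv /= !ltW.
move/subspace_continuousP : cg => /(_ tc tc01 O (open_nbhs_nbhs (conj oO Otc))).
move=> /nbhs_ballP[e e0 h]; exists e => // t te t01; apply: h.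
Qed.

Theorem corollary2p8 (R : realType) (d : nat) (hd : (0 < d)%N)
    (P : R -> R -> probability (config d) R) (hP : percolation_family P) :
  [/\ relatively_open unit_square (subcritical_set P),
      relatively_open unit_square (supercritical_set P),
      (forall p q : R, subcritical_set P (p, q) ->
         exists c : R, 0 < c /\
           \forall n \near \oo,
             (theta_n P n p q <= (expR (- (c * n%:R)))%:E)%E)
    & (forall p q : R, supercritical_set P (p, q) -> (0 < theta P p q)%E)]
  /\
  (forall gamma : R -> R * R,
     {within `[0, 1], continuous gamma} ->
     (forall t : R, 0 <= t <= 1 -> unit_square (gamma t)) ->
     forall tc : R, 0 < tc < 1 ->
     (forall t : R, 0 <= t < tc -> theta P (gamma t).1 (gamma t).2 = 0%E) ->
     (forall t : R, tc < t <= 1 -> (0 < theta P (gamma t).1 (gamma t).2)%E) ->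
     pc0 P <= (gamma tc).1 /\ (gamma tc).2 = qc P (gamma tc).1).
Proof.
have oS : relatively_open unit_square (subcritical_set P).
  by exists [set x | finite_criterion d x.1 x.2]; [exact: crit_open|exact: subcriticalE].
have oU := supercritical_open hd hP.
have dS p q : subcritical_set P (p, q) -> 0 <= p <= 1 /\ 0 <= q <= 1 /\ finite_criterion d p q.
  by rewrite subcriticalE // => -[[hp hq] c].
have pU p q : supercritical_set P (p, q) -> (0 < theta P p q)%E.
  by move=> [[hp hq] [_ h]]; apply: qc_lt.
split; first split => //.
  by move=> p q /dS[hp [hq c]]; exact: crit_decay.
move=> gamma cg sg tc htc h0 h1; have /andP[t0 t1] := htc.
have stc : unit_square (gamma tc) by apply: sg; rewrite !ltW.
(* By openness the path would still be subcritical shortly after [tc], where [theta] is positive. *)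
have nS : ~ subcritical_set P (gamma tc).
  case: oS => O oO eS; rewrite eS => -[_ Otc].
  have [e e0 he] := path_near cg htc oO Otc.
  pose t := Num.min 1 (tc + e / 2).
  have [tt te t01] : [/\ tc < t, `|tc - t| < e & 0 <= t <= 1].
    rewrite /t /Num.min; case: (ltP 1 (tc + e / 2)) => h.
      by split; [|rewrite ltr_distl; apply/andP; split; lra|rewrite ler01 lexx].
    by split; [lra|rewrite ltr_distl; apply/andP; split; lra|apply/andP; split; lra].
  have /andP[_ tle1] := t01.
  have : subcritical_set P (gamma t) by rewrite eS; split; [exact: sg|exact: he].
  have := h1 t; rewrite tt tle1 => /(_ isT).
  case: (gamma t) => p q /= th /dS[hp [hq c]]; move: th; apply/theta_eq0P.
  exact: (crit_theta0 hP).
(* Symmetrically, it would already be supercritical shortly before [tc], where [theta] vanishes. *)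
have nU : ~ supercritical_set P (gamma tc).
  case: oU => O oO eU; rewrite eU => -[_ Otc].
  have [e e0 he] := path_near cg htc oO Otc.
  pose t := Num.max 0 (tc - e / 2).
  have [tt te t01] : [/\ t < tc, `|tc - t| < e & 0 <= t <= 1].
    rewrite /t /Num.max; case: (ltP 0 (tc - e / 2)) => h.
      by split; [lra|rewrite ltr_distl; apply/andP; split; lra|apply/andP; split; lra].
    by split; [|rewrite ltr_distl; apply/andP; split; lra|rewrite ler01 lexx].
  have /andP[tge0 _] := t01.
  have : supercritical_set P (gamma t) by rewrite eU; split; [exact: sg|exact: he].
  have := h0 t; rewrite tt tge0 => /(_ isT).
  by case: (gamma t) => p q /= th /pU; apply/theta_eq0P.
move: stc nS nU; case: (gamma tc) => p q /= [hp hq] /= nS nU.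
have pp : pc0 P <= p.
  by rewrite leNgt; apply/negP => pp; apply: nS; split => //; left.
have qq : qc P p <= q.
  by rewrite leNgt; apply/negP => qq; apply: nS; split => //; right.
split => //; apply/eqP; rewrite eq_le qq andbT leNgt; apply/negP => lqq.
(* The supercritical set leaves out the line [p = pc0 P]; there [q] above [qc] is impossible because
   [qc] equals 1. *)
move: pp; rewrite le_eqVlt => /orP[/eqP pp|pp]; last by apply: nU.
by move: lqq; rewrite -pp (qc_pc0 hd hP) ltNge; case/andP: hq => _ ->.
Qed.
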